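(* Let $(E,\Phi,\Delta)$ be a simple based root system, and let $\lambda_1,\lambda_2,\mu_1,\mu_2$ be dominant regular weights such that each of $\mu_1,\mu_2$ is a positive integral multiple of $\rho$ or of $\tilde\rho$, and $\mu_i$ divides $\lambda_i$ for $i=1,2$. Suppose $S(\lambda_1)/S(\mu_1)=S(\lambda_2)/S(\mu_2)$ and that this quotient is not equal to $1$. Then $\lambda_1=\lambda_2$ and $\mu_1=\mu_2$. In particular, if $\lambda_1$ is a dominant regular weight which is neither a multiple of $\rho$ nor of $\tilde\rho$, $\lambda_2$ is dominant regular, and $C(\lambda_1)=C(\lambda_2)$, then $\lambda_1=\lambda_2$.
   Context: Notation: Weyl group $W$ with sign $\epsilon(w)=(-1)^{\ell(w)}$, coroots $\alpha^*$, weight lattice $P$, fundamental weights $\omega_\alpha$ ($\alpha\in\Delta$), $m_\alpha(\lambda)=\langle\alpha^*,\lambda\rangle$; dominant regular means $m_\alpha(\lambda)>0$ for all $\alpha\in\Delta$; $\rho=\sum_{\alpha\in\Delta}\omega_\alpha$; for a regular weight $\mu$, ''$\mu$ divides $\lambda$'' means $m_\alpha(\mu)\mid m_\alpha(\lambda)$ for all $\alpha\in\Delta$. $S(\lambda)=\sum_{w\in W}\epsilon(w)e^{w\lambda}$ in the group ring $\mathbb Z[P]$. $m(\Phi)$ is the ratio of the squared length of a long root to that of a short root; $\tilde\rho=\sum_{\alpha\in\Delta\text{ short}}m(\Phi)\omega_\alpha+\sum_{\alpha\in\Delta\text{ long}}\omega_\alpha$ ($=\rho$ if simply laced). For dominant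 regular $\lambda$, $D(\lambda)$ is the lcm in $\mathbb Z[P]^W$ (a polynomial ring over $\mathbb Z$) of all $S(d\rho)$ with $d\rho\mid\lambda$, $d\rho\ne\lambda$ and all $S(e\tilde\rho)$ with $e\tilde\rho\mid\lambda$, $e\tilde\rho\ne\lambda$, normalized to have positive leading coefficient for the dominance order, and $C(\lambda)=S(\lambda)/D(\lambda)$. *)

(* Defs.v *)
From HB Require Import structures.
From mathcomp Require Import all_boot all_order all_algebra.
From mathcomp Require Import boolp classical_sets cardinality fsbigop reals.

Set Implicit Arguments.
Unset Strict Implicit.
Unset Printing Implicit Defensive.
Import Order.TTheory GRing.Theory Num.Theory.
Local Open Scope classical_set_scope.
Local Open Scope ring_scope.

Section RootSystems.
Variables (R : realType) (n : nat).
Local Notation vec := 'rV[R]_n.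

Definition dot (u v : vec) : R := (u *m v^T) 0 0.

Definition cpair (a v : vec) : R := 2 * dot a v / dot a a.

(* matrix of the reflection s_a, acting on row vectors by v |-> v *m s_a *)
Definition refl_mx (a : vec) : 'M[R]_n := 1%:M - (2 / dot a a) *: (a^T *m a).

Definition is_int (x : R) : Prop := exists z : int, x = z%:~R.

Definition root_system (Phi : seq vec) : Prop :=
  [/\ (0 : vec) \notin Phi, (<<Phi>>%VS = fullv),
      (forall a b, a \in Phi -> b \in Phi -> b *m refl_mx a \in Phi),
      (forall a b, a \in Phi -> b \in Phi -> is_int (cpair a b))
    & (forall a (c : R), a \in Phi -> c *: a \in Phi -> c = 1 \/ c = -1)].

Definition irreducible_rs (Phi : seq vec) : Prop :=
  Phi <> [::] /\
  forall P1 : pred vec,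
    (forall a b, a \in Phi -> b \in Phi -> P1 a -> ~~ P1 b -> dot a b = 0) ->
    (forall a, a \in Phi -> P1 a) \/ (forall a, a \in Phi -> ~~ P1 a).

Definition is_base (Phi Delta : seq vec) : Prop :=
  [/\ {subset Delta <= Phi}, uniq Delta, free Delta &
      forall b, b \in Phi -> exists c : 'I_(size Delta) -> nat,
        b = \sum_i (c i)%:R *: Delta`_i \/ b = - \sum_i (c i)%:R *: Delta`_i].

Definition simple_based_root_system (Phi Delta : seq vec) : Prop :=
  [/\ root_system Phi, irreducible_rs Phi & is_base Phi Delta].

Inductive inW (Phi : seq vec) : 'M[R]_n -> Prop :=
| inW1 : inW Phi 1%:M
| inWr w a : inW Phi w -> a \in Phi -> inW Phi (w *m refl_mx a).

Definition WeylSet (Phi : seq vec) : set 'M[R]_n := [set w | inW Phi w].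

Definition word_mx (Delta : seq vec) (s : seq 'I_(size Delta)) : 'M[R]_n :=
  foldr (fun (i : 'I_(size Delta)) M => refl_mx Delta`_i *m M) 1%:M s.

Definition wlength (Delta : seq vec) (w : 'M[R]_n) : nat :=
  xget 0%N [set k | (exists s : seq 'I_(size Delta), size s = k /\ word_mx s = w) /\
                    (forall s : seq 'I_(size Delta), word_mx s = w -> (k <= size s)%N)].

Definition eps (Delta : seq vec) (w : 'M[R]_n) : int := (-1) ^+ wlength Delta w.

Definition inP (Phi : seq vec) (v : vec) : Prop :=
  forall a, a \in Phi -> is_int (cpair a v).

(* group ring Z[P]: finitely supported Z-valued functions on P *)
Definition GR := vec -> int.
Definition supp (f : GR) : set vec := [set mu | f mu != 0].
Definition inZP (Phi : seq vec) (f : GR) : Prop :=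
  finite_set (supp f) /\ supp f `<=` inP Phi.
Definition mulGR (f g : GR) : GR :=
  fun mu => \sum_(nu \in [set: vec]) (f nu * g (mu - nu)).
Definition dvdGR (Phi : seq vec) (f g : GR) : Prop :=
  exists q, inZP Phi q /\ g = mulGR f q.
Definition Winv (Phi : seq vec) (f : GR) : Prop :=
  forall w, inW Phi w -> forall mu, f (mu *m w) = f mu.

(* S(lambda) = sum_{w in W} eps(w) e^{w lambda} *)
Definition S (Phi Delta : seq vec) (lam : vec) : GR :=
  fun mu => \sum_(w \in WeylSet Phi) (if lam *m w == mu then eps Delta w else 0).

Definition dom_reg (Phi Delta : seq vec) (lam : vec) : Prop :=
  inP Phi lam /\ forall a, a \in Delta -> 0 < cpair a lam.

Definition omega (Delta : seq vec) (i : 'I_(size Delta)) : vec :=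
  xget 0 [set v | forall j : 'I_(size Delta), cpair Delta`_j v = (i == j)%:R].
Definition rho (Delta : seq vec) : vec := \sum_(i < size Delta) omega (Delta:=Delta) i.
Definition maxlen (Phi : seq vec) : R := \big[Num.max/0]_(a <- Phi) dot a a.
Definition minlen (Phi : seq vec) : R := \big[Num.min/maxlen Phi]_(a <- Phi) dot a a.
Definition mPhi (Phi : seq vec) : R := maxlen Phi / minlen Phi.
Definition is_long (Phi : seq vec) (a : vec) : bool := dot a a == maxlen Phi.
Definition rhot (Phi Delta : seq vec) : vec :=
  \sum_(i < size Delta) (if is_long Phi Delta`_i then 1 else mPhi Phi) *: omega (Delta:=Delta) i.

Definition wdivides (Delta : seq vec) (mu lam : vec) : Prop :=
  forall a, a \in Delta -> exists k : int, cpair a lam = k%:~R * cpair a mu.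

Definition pos_mult (r mu : vec) : Prop := exists d : nat, (0 < d)%N /\ mu = d%:R *: r.
Definition int_mult (r mu : vec) : Prop := exists k : int, mu = k%:~R *: r.

Definition dom_le (Delta : seq vec) (mu nu : vec) : Prop :=
  exists c : 'I_(size Delta) -> nat, nu - mu = \sum_i (c i)%:R *: Delta`_i.

Definition lead_pos (Delta : seq vec) (f : GR) : Prop :=
  (exists mu, f mu != 0) /\
  forall mu, f mu != 0 ->
    (forall nu, f nu != 0 -> dom_le Delta mu nu -> nu = mu) -> 0 < f mu.

Definition proper_special (Phi Delta : seq vec) (lam mu : vec) : Prop :=
  [/\ pos_mult (rho Delta) mu \/ pos_mult (rhot Phi Delta) mu,
      wdivides Delta mu lam & mu <> lam].

(* D is D(lambda): the normalized lcm in Z[P]^W of the S(mu), mu proper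
   special, where Z[P]^{-W} is identified with Z[P]^W via division by
   S(rho) (i.e. "S(mu) | S(rho) D" in Z[P]). *)
Definition is_D (Phi Delta : seq vec) (lam : vec) (D : GR) : Prop :=
  [/\ inZP Phi D, Winv Phi D, lead_pos Delta D,
      (forall mu, proper_special Phi Delta lam mu ->
          dvdGR Phi (S Phi Delta mu) (mulGR (S Phi Delta (rho Delta)) D))
    & (forall M, inZP Phi M -> Winv Phi M ->
        (forall mu, proper_special Phi Delta lam mu ->
          dvdGR Phi (S Phi Delta mu) (mulGR (S Phi Delta (rho Delta)) M)) ->
        dvdGR Phi D M)].

End RootSystems.

(* Main.v *)
Require Import Defs.
From HB Require Import structures.
From mathcomp Require Import all_boot all_order all_algebra.
From mathcomp Require Import finmap boolp classical_sets cardinality fsbigop reals.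
From mathcomp Require Import sequences exp.
From mathcomp Require Import algC cyclotomic.
From mathcomp Require Import ring lra zify.
Set Implicit Arguments.
Unset Strict Implicit.
Unset Printing Implicit Defensive.
Import Order.TTheory GRing.Theory Num.Theory.

(** Comparing leading exponents in [S lam1 * S mu2 = S lam2 * S mu1] gives
    [lam1 + mu2 = lam2 + mu1].  Restricting to the edge of the weight polytope in the direction
    of a simple root [a] turns [S lam] into [e^lam - e^(s_a lam)], so that for every [a] either
    [m_a lam1 = m_a lam2] or [m_a lam1 = m_a mu1].  If [mu1 <= mu2] coordinatewise, evaluate at
    the half sum of positive coroots: by the Weyl denominator formula of the dual root system
    [S lam] becomes, up to an exponential factor, the product over positive roots [b] of
    [1 - exp (- <b^*, lam>)].  The factors of the left-hand side dominate those of the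
    right-hand side, and strictly so at a root of full support unless [mu1 = mu2] or
    [lam1 = mu1].  Two multiples of [rho] or [rhot] are either comparable or differ at every
    simple root, and in the latter case the edges alone force [lam1 = mu1].

    For [C lam], the denominator formula shows that [S nu] divides [S mu] for special [nu]
    dividing [mu]; hence [D lam = S mu / S rho] as soon as [lam] has a greatest proper special
    divisor [mu], and the first part applies.  Such a [mu] always exists if [lam] is not special.
    If [lam2] is special, comparing multiplicities of roots of unity along an edge shows that
    [C lam1 = C lam2] with [lam1] not special is only possible when it exists as well. *)

(** * Arithmetic of special weights *)

(** The two families of special weights have one origin. If [c] is a positive Weyl-invariant
    function on the roots with suitable integrality, the vectors [c b *: b] behave like a root
    system with the same Weyl group, and the alternating sum of their half sum is a product over the
    positive roots. A constant [c] gives the multiples of [rho], [c] inversely proportional to the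
    squared length gives those of [rhot], and also the dual system needed for the evaluation at
    coroots. The obstacle in the second half is that the lcm is known only through divisibilities.
    When a greatest proper special divisor [mu] exists, the lcm and [S mu / S rho] divide each
    other, hence differ by a unit of the group ring, that is by plus or minus an exponential;
    invariance removes the exponential and the normalization removes the sign. A special weight may
    have no such [mu]: [6 rho] is properly divided by [2 rho] and [3 rho], and a common special
    multiple of these dividing [6 rho] is [6 rho] itself. For such weights only the divisibility of
    the lcm by each [S delta] can be exploited, which is what the zeros at roots of unity do. *)

Section SpecialFunctions.
Variables (I : finType) (L : pred I) (m : nat).
Implicit Types (x y z lam : I -> nat) (d e g : nat).

(* [x i] stands for the multiplicity of a weight at the [i]-th simple root: the two alternatives
   are [d rho] and [e rhot], where [L] marks the long simple roots. *)
Definition spf x :=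
  (exists2 d, 0 < d & forall i, x i = d) \/
  (exists2 e, 0 < e & forall i, x i = if L i then e else m * e).
Definition dvf x y := forall i, x i %| y i.
Definition pspf lam x := [/\ spf x, dvf x lam & exists i, x i != lam i].
Definition maxspf lam x := pspf lam x /\ forall y, pspf lam y -> dvf y x.

(** The ratio of squared root lengths is 1, 2 or 3, and if it is 1 every root is long. *)
Hypothesis mP : (forall i, L i) \/ prime m.

Lemma spf_const x : (forall i, L i) -> spf x -> exists2 d, 0 < d & forall i, x i = d.
Proof. by move=> hL [//|[e e0 h]]; exists e => // i; rewrite h hL. Qed.

Lemma spf_gt0 x i : spf x -> 0 < x i.
Proof.
case=> -[d d0 h]; rewrite h //; case: ifP => // Li; rewrite muln_gt0 d0 andbT.
by case: mP => [hL|/prime_gt0 //]; rewrite hL in Li.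
Qed.

Lemma prime_quot l t : prime m -> 0 < l -> l %| t -> t %| m * l -> t = l \/ t = m * l.
Proof.
move=> pm l0 /dvdnP[k ->]; rewrite dvdn_pmul2r // => /(primeP pm).2.
by move=> /orP[]/eqP ->; rewrite ?mul1n; [left|right].
Qed.

(** Two functions of the same shape are joined by an lcm of their parameters. For a constant [d]
    against [e], [m * e], put [l = lcmn d e]: the join is [l] at long simple roots and, at short
    ones, a multiple of [l] dividing [m * l]. As [m] is prime it is [l] or [m * l], and both
    outcomes are special. *)
Lemma spf_join x y lam : spf x -> spf y -> dvf x lam -> dvf y lam ->
  exists z, [/\ spf z, dvf z lam, dvf x z & dvf y z].
Proof.
case: mP => [hL /(spf_const hL)[d d0 hx] /(spf_const hL)[e e0 hy] dx dy|pm].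
  exists (fun=> lcmn d e); split.
  - by left; exists (lcmn d e); rewrite ?lcmn_gt0 ?d0.
  - by move=> i; rewrite dvdn_lcm -{1}(hx i) -(hy i) dx dy.
  - by move=> i; rewrite hx dvdn_lcml.
  - by move=> i; rewrite hy dvdn_lcmr.
have m0 := prime_gt0 pm.
have mix d e x' y' : 0 < d -> 0 < e -> (forall i, x' i = d) ->
    (forall i, y' i = if L i then e else m * e) -> dvf x' lam -> dvf y' lam ->
    exists z, [/\ spf z, dvf z lam, dvf x' z & dvf y' z].
  move=> d0 e0 hx hy dx dy; set l := lcmn d e.
  have l0 : 0 < l by rewrite lcmn_gt0 d0.
  have sh i : ~~ L i -> lcmn d (m * e) %| lam i.
    by move=> /negPf Li; rewrite dvdn_lcm -{1}(hx i) dx; have := dy i; rewrite hy Li.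
  have lo i : L i -> l %| lam i.
    by move=> Li; rewrite dvdn_lcm -{1}(hx i) dx; have := dy i; rewrite hy Li.
  have [] := @prime_quot l (lcmn d (m * e)) pm l0.
  - by rewrite dvdn_lcm dvdn_lcml (dvdn_trans _ (dvdn_lcmr _ _)) // dvdn_mull.
  - by rewrite dvdn_lcm dvdn_pmul2l // dvdn_lcmr dvdn_mull // dvdn_lcml.
  - move=> e1; exists (fun=> l); split.
    + by left; exists l.
    + by move=> i; case: (boolP (L i)) => [/lo //|/sh]; rewrite e1.
    + by move=> i; rewrite hx dvdn_lcml.
    + by move=> i; rewrite hy; case: ifP => _; rewrite ?dvdn_lcmr // -e1 dvdn_lcmr.
  - move=> e1; exists (fun i => if L i then l else m * l); split.
    + by right; exists l.
    + by move=> i; case: (boolP (L i)) => [/lo //|/sh]; rewrite e1.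
    + by move=> i; rewrite hx; case: ifP => _; rewrite ?dvdn_mull // dvdn_lcml.
    + by move=> i; rewrite hy; case: ifP => _; rewrite ?dvdn_pmul2l // dvdn_lcmr.
case=> -[d d0 hx] [] [e e0 hy] dx dy.
- exists (fun=> lcmn d e); split.
  + by left; exists (lcmn d e); rewrite ?lcmn_gt0 ?d0.
  + by move=> i; rewrite dvdn_lcm -{1}(hx i) -(hy i) dx dy.
  + by move=> i; rewrite hx dvdn_lcml.
  + by move=> i; rewrite hy dvdn_lcmr.
- exact: (mix d e).
- by have [z [? ? ? ?]] := mix e d y x e0 d0 hy hx dy dx; exists z.
- exists (fun i => if L i then lcmn d e else m * lcmn d e); split.
  + by right; exists (lcmn d e); rewrite ?lcmn_gt0 ?d0.
  + move=> i; have := dx i; have := dy i; rewrite hx hy; case: ifP => _ h1 h2.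
      by rewrite dvdn_lcm h1 h2.
    by rewrite muln_lcmr dvdn_lcm h1 h2.
  + by move=> i; rewrite hx; case: ifP => _; rewrite ?dvdn_pmul2l // dvdn_lcml.
  + by move=> i; rewrite hy; case: ifP => _; rewrite ?dvdn_pmul2l // dvdn_lcmr.
Qed.

(** Choose a special divisor with the largest sum of values: its join with any other one cannot have
    a larger sum, hence coincides with it. As [lam] is not special, all its special divisors are
    proper. *)
Lemma maxspf_nonspecial lam : (forall i, 0 < lam i) -> ~ spf lam -> exists x, maxspf lam x.
Proof.
move=> l0 nl.
pose P k := `[< exists x, [/\ spf x, dvf x lam & \sum_i x i = k] >].
have exP : exists k, P k.
  exists (\sum_(i : I) 1); apply/asboolP; exists (fun=> 1); split=> //; by left; exists 1.
have bP k : P k -> k <= \sum_i lam i.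
  case/asboolP=> x [_ dx <-]; apply: leq_sum => i _; exact: dvdn_leq.
case: (ex_maxnP exP bP) => k /asboolP[x [sx dx ex]] mx; exists x.
have ne y : spf y -> exists i, y i != lam i.
  move=> sy; apply/existsP; apply: contraT; rewrite negb_exists => /forallP h.
  case: nl; have e i : y i = lam i by apply/eqP; have := h i; rewrite negbK.
  by case: sy => -[d d0 hd]; [left|right]; exists d => // i; rewrite -e hd.
split; first by split=> //; apply: ne.
move=> y [sy dy _]; have [z [sz dz xz yz]] := spf_join sx sy dx dy.
have le i : x i <= z i by apply: dvdn_leq (xz i); apply: spf_gt0.
have : \sum_i z i <= k by apply: mx; apply/asboolP; exists z.
rewrite -ex => hle.
have eqs : \sum_i x i == \sum_i z i by rewrite eqn_leq hle leq_sum.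
have /forallP eqi : [forall i, x i == z i].
  by rewrite (leqif_sum (fun i _ => leqif_eq (le i))).2 in eqs.
by move=> i; rewrite (eqP (eqi i)).
Qed.

(* [a] and [b] are the values at [i] of the two weights of a quotient equal to the quotient
   attached to the special [lam]. *)
Lemma maxspf_special lam i a b : spf lam -> 0 < a -> b %| a -> b != a -> a %| lam i ->
  (forall y, pspf lam y -> ~~ (a %| y i)) ->
  (forall y, pspf lam y -> gcdn a (y i) %| b) -> exists x, maxspf lam x.
Proof.
move=> sl a0 ba nba al na gb.
have b0 : 0 < b by apply: dvdn_gt0 ba.
(* If [lam] is constantly [g], the constant [a] would be a proper special divisor contradicting [na]
   unless [a = g]. Then [gb] puts every proper divisor of [g] below [b], so [g] is a prime power and
   [b] its greatest proper divisor. *)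
have constcase g : 0 < g -> (forall j, lam j = g) ->
    a = g /\ forall d, d %| g -> d != g -> 0 < d -> d %| b.
  move=> g0 hg; have ag : a = g.
    apply/eqP; apply: contraT => ne; rewrite hg in al.
    have /na : pspf lam (fun=> a).
      by split; [left; exists a|move=> j; rewrite hg|exists i; rewrite hg].
    by rewrite dvdnn.
  split=> // d dg ne d0; have := gb (fun=> d) _; rewrite ag => h.
  have -> : d = gcdn g d by rewrite gcdnC; apply/esym/gcdn_idPl.
  by apply: h; split; [left; exists d|move=> j; rewrite hg|exists i; rewrite hg].
have constmax g : 0 < g -> (forall j, lam j = g) ->
    (forall y, pspf lam y -> (exists2 d, 0 < d & forall j, y j = d) \/
       (forall j, y j %| b)) -> exists x, maxspf lam x.
  move=> g0 hg hy; have [ag hd] := constcase g g0 hg.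
  exists (fun=> b); split.
    by split; [left; exists b|move=> j; rewrite hg -ag|exists i; rewrite hg -ag].
  move=> y py; case: (hy y py) => [[d d0 hd']|//] j.
  have [_ dv [k]] := py; rewrite hd' hg => ne.
  by rewrite hd'; apply: hd => //; rewrite -(hd' i) -(hg i).
case: (boolP [forall j, L j]) => [/forallP hL|].
  have [g g0 hg] := spf_const hL sl.
  by apply: (constmax g) => // y [sy _ _]; left; apply: spf_const sy.
rewrite negb_forall => /existsP[j0 nL].
have pm : prime m by case: mP => // h; rewrite h in nL.
have m0 := prime_gt0 pm; have m1 := prime_gt1 pm.
case: sl => -[g g0 hg].
  have [ag hd] := constcase g g0 hg; subst g.
  (* Here [lam] is constant but there are short simple roots, so functions of the second shape
     compete with the constant [b]. If [i] is short, [gb] bounds them by [b] directly. *)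
  case: (boolP (L i)) => Li; last first.
    apply: (constmax a) => // y py; have [sy dy _] := py.
    case: sy => [|[e e0 he]]; [by left|right].
    have yi : y i = m * e by rewrite he (negPf Li).
    have meb : m * e %| b.
      have := gb y py; rewrite yi; have := dy i; rewrite hg yi => /gcdn_idPl.
      by rewrite gcdnC => ->.
    by move=> j; rewrite he; case: ifP => _ //; apply: dvdn_trans meb; apply: dvdn_mull.
  (* At the short root [j0] a competitor of the second shape takes a multiple of [m], so there is
     none unless [m] divides [a]. If it does, [b = a %/ m] and the greatest proper divisor has the
     second shape: it is smaller than [lam] only at long roots. *)
  case: (boolP (m %| a)) => [ma|nma]; last first.
    apply: (constmax a) => // y py; have [sy dy _] := py.
    case: sy => [|[e e0 he]]; first by left.
    by case/negP: nma; have := dy j0; rewrite hg he (negPf nL); apply: dvdn_trans; apply: dvdn_mulr.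
  have ea : m * (a %/ m) = a by rewrite mulnC divnK.
  have q0 : 0 < a %/ m by rewrite divn_gt0 // dvdn_leq.
  have nq : a %/ m != a by rewrite neq_ltn ltn_Pdiv.
  have qb : a %/ m %| b by apply: hd; rewrite // -{2}ea dvdn_mull.
  have eb : b = a %/ m.
    have := prime_quot pm q0 qb; rewrite ea => /(_ ba)[//|e].
    by rewrite e eqxx in nba.
  exists (fun j => if L j then b else m * b); split.
    split; first by right; exists b.
      by move=> j; rewrite hg eb; case: ifP => _; rewrite ?ea // -{2}ea dvdn_mull.
    by exists i; rewrite Li hg.
  move=> y [sy dy [k ne]] j; case: sy => -[d d0 hy].
    have db : d %| b by apply: hd => //; rewrite -?(hy k) -(hg k).
    by rewrite hy; case: ifP => _ //; apply: dvdn_mull.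
  have db : d %| b.
    by rewrite -(dvdn_pmul2l m0) eb ea -(hg j0); have := dy j0; rewrite hy (negPf nL).
  by rewrite hy; case: ifP => _ //; rewrite dvdn_pmul2l.
have gm : g != m * g by rewrite neq_ltn ltn_Pmull.
have psg d : 0 < d -> d %| g -> pspf lam (fun=> d).
  move=> d0 dg; split; first by left; exists d.
    by move=> j; rewrite hg; case: ifP => _ //; apply: dvdn_mull.
  exists j0; rewrite hg (negPf nL) neq_ltn (leq_ltn_trans (dvdn_leq g0 dg)) //.
  by rewrite ltn_Pmull.
have nag : ~~ (a %| g) by have := na _ (psg g g0 (dvdnn g)).
(* Now [lam] is [g] at long roots and [m * g] at short ones. The constant [g] is a proper special
   divisor, so [na] forbids [a] to divide [g] and [i] must be short. *)
case: (boolP (L i)) => Li; first by move: al; rewrite hg Li (negPf nag).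
rewrite hg (negPf Li) in al.
(* Since [a] divides [m * g] but not [g], it is divisible by [m]; if [a %/ m] were not [g], the
   function of the second shape with parameter [a %/ m] would be a proper divisor with value [a] at
   [i]. *)
have ea : a = m * g.
  case: (boolP (m %| a)) => [ma|nma]; last first.
    by move: al; rewrite Gauss_dvdr ?(negPf nag) // coprime_sym prime_coprime.
  have e1 : m * (a %/ m) = a by rewrite mulnC divnK.
  have qg : a %/ m %| g by rewrite -(dvdn_pmul2l m0) e1.
  have q0 : 0 < a %/ m by rewrite divn_gt0 // dvdn_leq.
  case: (eqVneq (a %/ m) g) => [<- //|ne].
  have /na : pspf lam (fun j => if L j then a %/ m else m * (a %/ m)).
    split; first by right; exists (a %/ m).
      by move=> j; rewrite hg; case: ifP => _; rewrite ?dvdn_pmul2l.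
    by exists i; rewrite hg (negPf Li) eqn_pmul2l // -lt0n.
  by rewrite (negPf Li) e1 dvdnn.
have gb' : g %| b.
  have := gb _ (psg g g0 (dvdnn g)); rewrite ea => h.
  by apply: dvdn_trans h; rewrite dvdn_gcd dvdnn dvdn_mull.
have eb : b = g.
  have := prime_quot pm g0 gb'; rewrite -ea => /(_ ba)[//|e].
  by rewrite e eqxx in nba.
exists (fun=> g); split; first exact: psg.
move=> y py j; have [sy dy [k ne]] := py; case: sy => -[d d0 hy].
  have h := gb y py; rewrite hy ea eb in h; rewrite hy; apply: dvdn_trans h.
  by rewrite dvdn_gcd dvdnn andbT; have := dy i; rewrite hy hg (negPf Li).
have h : m * d %| g.
  have := gb y py; rewrite hy (negPf Li) ea eb; apply: dvdn_trans.
  by rewrite dvdn_gcd dvdnn andbT; have := dy i; rewrite hy hg (negPf Li).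
by rewrite hy; case: ifP => _ //; apply: dvdn_trans h; apply: dvdn_mull.
Qed.

End SpecialFunctions.

Local Open Scope ring_scope.

(** * Group algebra *)

Section GroupAlgebra.
Variables (R : realType) (n : nat).
Local Notation V := 'rV[R]_n.

(** Exponents range over the whole space, so that the ring does not depend on a root system; that a
    support lies in the weight lattice is tracked separately by [suppP]. *)
Record ga := Ga { coef :> V -> int; ga_fin : finite_set (supp (coef : GR R n)) }.

HB.instance Definition _ := gen_eqMixin ga.
HB.instance Definition _ := gen_choiceMixin ga.

Implicit Types (f g h : ga) (v w : V).

Lemma ga_ext f g : coef f = coef g -> f = g.
Proof. by case: f g => [f ff] [g gf] /= e; subst g; congr Ga; apply: Prop_irrelevance. Qed.

Definition gsupp f : seq V := fset_set (supp (coef f : GR R n)).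

Lemma mem_gsupp f v : (v \in gsupp f) = (f v != 0).
Proof.
rewrite /gsupp in_fset_set; last exact: ga_fin.
by apply/idP/idP; rewrite inE.
Qed.

Lemma gsupp_uniq f : uniq (gsupp f).
Proof. exact: fset_uniq. Qed.

Lemma finite_supp (f : V -> int) (s : seq V) :
  (forall v, f v != 0 -> v \in s) -> finite_set (supp (f : GR R n)).
Proof. by move=> h; apply: (sub_finite_set (B := [set` s])) => // v /h. Qed.

Section Pairing.
Variable A : zmodType.
Implicit Types phi psi : V -> A.

(** The linear extension of [phi] to the group algebra. Testing against all [phi] determines [f],
    which reduces the ring laws to rearrangements of sums; for multiplicative [phi] it is a ring
    morphism. *)
Definition ev f phi : A := \sum_(v <- gsupp f) phi v *~ f v.

Lemma ev_widen (s : seq V) f phi : uniq s -> (forall v, f v != 0 -> v \in s) ->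
  ev f phi = \sum_(v <- s) phi v *~ f v.
Proof.
move=> us sub; rewrite /ev [RHS](bigID (fun v => v \in gsupp f)) /=.
rewrite [X in _ + X]big1 ?addr0; last first.
  by move=> v; rewrite mem_gsupp negbK => /eqP ->.
rewrite -[RHS]big_filter; apply: perm_big; apply: uniq_perm; rewrite ?gsupp_uniq ?filter_uniq //.
move=> v; rewrite mem_filter; case: (boolP (v \in gsupp f)) => //=.
by rewrite mem_gsupp => /sub ->.
Qed.

Lemma eq_ev f phi psi : (forall v, f v != 0 -> phi v = psi v) -> ev f phi = ev f psi.
Proof. by move=> e; apply: eq_big_seq => v; rewrite mem_gsupp => /e ->. Qed.

End Pairing.

Lemma gcoef_ev f v : f v = ev f (fun u => (u == v)%:R).
Proof.
rewrite (@ev_widen _ (undup (v :: gsupp f))) ?undup_uniq //; last first.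
  by move=> u; rewrite mem_undup inE mem_gsupp => ->; rewrite orbT.
rewrite (bigD1_seq v) ?undup_uniq ?mem_undup ?mem_head //= eqxx big1 ?addr0.
  by rewrite -[LHS]intz.
by move=> u /negPf ->; rewrite mul0rz.
Qed.

Lemma ga_evP f g : (forall phi : V -> int, ev f phi = ev g phi) -> f = g.
Proof. by move=> e; apply/ga_ext/funext => v; rewrite !gcoef_ev e. Qed.

Lemma ga0_fin : finite_set (supp ((fun=> 0) : GR R n)).
Proof. by apply: (@finite_supp _ [::]) => v; rewrite eqxx. Qed.
Lemma gaN_fin f : finite_set (supp ((fun v => - f v) : GR R n)).
Proof. by apply: (@finite_supp _ (gsupp f)) => v; rewrite oppr_eq0 mem_gsupp. Qed.
Lemma gaD_fin f g : finite_set (supp ((fun v => f v + g v) : GR R n)).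
Proof.
apply: (@finite_supp _ (gsupp f ++ gsupp g)) => v; rewrite mem_cat !mem_gsupp.
by apply: contraNT; rewrite negb_or !negbK => /andP[/eqP -> /eqP ->].
Qed.

Lemma mulGRE f g v : mulGR (f : GR R n) g v = \sum_(u <- gsupp f) f u * g (v - u).
Proof.
rewrite /mulGR (@fsbigTE _ _ _ _ (fset_set (supp (coef f : GR R n)))) // => u h.
have : u \notin gsupp f by [].
by rewrite mem_gsupp negbK => /eqP ->; rewrite mul0r.
Qed.

Definition sumsupp f g : seq V := undup [seq u + v | u <- gsupp f, v <- gsupp g].

Lemma mulGR_supp f g v : mulGR (f : GR R n) g v != 0 -> v \in sumsupp f g.
Proof.
rewrite mulGRE mem_undup; apply: contraNT => h; apply/eqP/big1_seq => u /= fu.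
case: (eqVneq (g (v - u)) 0) => [->|gu]; first by rewrite mulr0.
by case/negP: h; apply/allpairsP; exists (u, v - u); rewrite /= [u + _]addrC subrK fu mem_gsupp gu.
Qed.

Lemma gaM_fin f g : finite_set (supp (mulGR (f : GR R n) g)).
Proof. by apply: (@finite_supp _ (sumsupp f g)) => v; apply: mulGR_supp. Qed.

Definition ga0 := Ga ga0_fin.
Definition gaN f := Ga (gaN_fin f).
Definition gaD f g := Ga (gaD_fin f g).
Definition gaM f g := Ga (gaM_fin f g).

Lemma ev_gaM (A : zmodType) f g (phi : V -> A) :
  ev (gaM f g) phi = ev f (fun v => ev g (fun w => phi (v + w))).
Proof.
rewrite (@ev_widen _ (sumsupp f g)) ?undup_uniq //; last by move=> v /mulGR_supp.
under eq_bigr => v _ do rewrite /= mulGRE mulrz_sumr.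
rewrite exchange_big /=; apply: eq_big_seq => u fu.
rewrite (@ev_widen _ [seq v - u | v <- sumsupp f g]); last first.
- move=> w gw; apply/mapP; exists (w + u); last by rewrite addrK.
  by rewrite mem_undup; apply/allpairsP; exists (u, w); rewrite /= fu mem_gsupp gw addrC.
- by rewrite map_inj_uniq ?undup_uniq //; apply: addIr.
rewrite big_map mulrz_suml; apply: eq_bigr => v _.
by rewrite [u + _]addrC subrK mulrC mulrzA.
Qed.

Lemma ev_gaD (A : zmodType) f g (phi : V -> A) : ev (gaD f g) phi = ev f phi + ev g phi.
Proof.
have us := undup_uniq (gsupp f ++ gsupp g).
have sf v : f v != 0 -> v \in undup (gsupp f ++ gsupp g).
  by rewrite mem_undup mem_cat !mem_gsupp => ->.
have sg v : g v != 0 -> v \in undup (gsupp f ++ gsupp g).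
  by rewrite mem_undup mem_cat !mem_gsupp => ->; rewrite orbT.
rewrite (ev_widen phi us sf) (ev_widen phi us sg) (ev_widen phi us); last first.
  move=> v /= fg; case: (eqVneq (f v) 0) => [f0|/sf //].
  by apply: sg; move: fg; rewrite f0 add0r.
by rewrite -big_split; apply: eq_bigr => v _ /=; rewrite mulrzDr.
Qed.

Lemma gaDA : associative gaD.
Proof. by move=> f g h; apply/ga_ext/funext => v /=; rewrite addrA. Qed.
Lemma gaDC : commutative gaD.
Proof. by move=> f g; apply/ga_ext/funext => v /=; rewrite addrC. Qed.
Lemma ga0D : left_id ga0 gaD.
Proof. by move=> f; apply/ga_ext/funext => v /=; rewrite add0r. Qed.
Lemma gaND : left_inverse ga0 gaN gaD.
Proof. by move=> f; apply/ga_ext/funext => v /=; rewrite addNr. Qed.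

HB.instance Definition _ := GRing.isZmodule.Build ga gaDA gaDC ga0D gaND.

Lemma mono_fin v : finite_set (supp ((fun u => (u == v)%:R) : GR R n)).
Proof. by apply: (@finite_supp _ [:: v]) => u; rewrite inE; case: (u == v). Qed.

Definition mono v := Ga (mono_fin v).

Lemma ev_mono (A : zmodType) v (phi : V -> A) : ev (mono v) phi = phi v.
Proof.
rewrite (@ev_widen _ [:: v]) //; last by move=> u; rewrite inE /=; case: (u == v).
by rewrite big_seq1 /= eqxx.
Qed.

Lemma gaMA : associative gaM.
Proof.
move=> f g h; apply: ga_evP => phi; rewrite !ev_gaM; apply: eq_bigr => v _.
by rewrite ev_gaM; congr (_ *~ _); do 2! (apply: eq_ev => ? _); rewrite addrA.
Qed.
Lemma gaMC : commutative gaM.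
Proof.
move=> f g; apply: ga_evP => phi; rewrite !ev_gaM /ev.
under eq_bigr => v _ do rewrite mulrz_suml.
under [RHS]eq_bigr => v _ do rewrite mulrz_suml.
rewrite exchange_big /=; apply: eq_bigr => v _; apply: eq_bigr => w _.
by rewrite addrC mulrzAC.
Qed.
Lemma ga1M : left_id (mono 0) gaM.
Proof.
move=> f; apply: ga_evP => phi; rewrite ev_gaM ev_mono.
by apply: eq_bigr => v _; rewrite add0r.
Qed.
Lemma gaMDl : left_distributive gaM +%R.
Proof. by move=> f g h; apply: ga_evP => phi; rewrite !(ev_gaD, ev_gaM). Qed.
Lemma ga1_neq0 : mono 0 != 0.
Proof. by apply/eqP => /(congr1 (fun f : ga => f 0)) /=; rewrite eqxx. Qed.

HB.instance Definition _ :=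
  GRing.Zmodule_isComNzRing.Build ga gaMA gaMC ga1M gaMDl ga1_neq0.

Lemma gcoefM f g : (f * g : ga) = mulGR (f : GR R n) g :> (V -> int).
Proof. by []. Qed.
Lemma gcoefD f g v : (f + g) v = f v + g v. Proof. by []. Qed.
Lemma gcoefN f v : (- f) v = - f v. Proof. by []. Qed.
Lemma gcoef0 v : (0 : ga) v = 0. Proof. by []. Qed.
Lemma gcoef1 v : (1 : ga) v = (v == 0)%:R. Proof. by []. Qed.
Lemma gcoef_mono v u : mono v u = (u == v)%:R. Proof. by []. Qed.
Lemma gcoef_sum (I : Type) (r : seq I) (F : I -> ga) v :
  (\sum_(i <- r) F i) v = \sum_(i <- r) F i v.
Proof. by elim/big_rec2: _ => // i y1 y2 _ <-. Qed.
Lemma gcoefMz f (k : int) v : (f *~ k) v = f v *~ k.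
Proof.
have hn m : (f *+ m) v = f v *+ m by elim: m => // m IH; rewrite !mulrS gcoefD IH.
by case: k => m; rewrite -?pmulrn ?hn // ?NegzE !mulrNz gcoefN -!pmulrn hn.
Qed.

Section PairingTheory.
Variable A : zmodType.
Implicit Types phi : V -> A.

Lemma evM f g phi : ev (f * g) phi = ev f (fun v => ev g (fun w => phi (v + w))).
Proof. exact: ev_gaM. Qed.
Lemma evD f g phi : ev (f + g) phi = ev f phi + ev g phi.
Proof. exact: ev_gaD. Qed.
Lemma ev0 phi : ev 0 phi = 0.
Proof. by rewrite (@ev_widen _ [::]) ?big_nil // => v; rewrite eqxx. Qed.
Lemma evN f phi : ev (- f) phi = - ev f phi.
Proof. by apply/eqP; rewrite -addr_eq0 -evD addNr ev0. Qed.
Lemma evMz f (k : int) phi : ev (f *~ k) phi = ev f phi *~ k.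
Proof.
have hn m : ev (f *+ m) phi = ev f phi *+ m.
  by elim: m => [|m IH]; rewrite ?ev0 // !mulrS evD IH.
by case: k => m; rewrite -?pmulrn ?hn // ?NegzE !mulrNz evN -!pmulrn hn.
Qed.
Lemma ev_sum (I : Type) (r : seq I) (F : I -> ga) phi :
  ev (\sum_(i <- r) F i) phi = \sum_(i <- r) ev (F i) phi.
Proof. by elim/big_rec2: _ => [|i y1 y2 _ <-]; rewrite ?ev0 ?evD. Qed.

End PairingTheory.

Lemma monoD v w : mono (v + w) = mono v * mono w.
Proof. by apply: ga_evP => phi; rewrite evM !ev_mono. Qed.

Lemma gcoef_monoM v f u : (mono v * f) u = f (u - v).
Proof.
rewrite gcoef_ev evM ev_mono gcoef_ev; apply: eq_ev => w _.
by rewrite [in RHS]eq_sym subr_eq eq_sym addrC.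
Qed.

Lemma gmono_inj v w : mono v = mono w -> v = w.
Proof.
by move=> /(congr1 (fun f : ga => f v)); rewrite !gcoef_mono eqxx; case: eqP.
Qed.

(** Multiplicativity is asked on the two supports only, because the characters [zchar] below are
    multiplicative merely on the weight lattice. *)
Lemma ev_char (A : comNzRingType) f g (chi : V -> A) :
  (forall v w, f v != 0 -> g w != 0 -> chi (v + w) = chi v * chi w) ->
  ev (f * g) chi = ev f chi * ev g chi.
Proof.
move=> h; rewrite evM /ev mulr_suml; apply: eq_big_seq => v; rewrite mem_gsupp => fv.
rewrite mulrzAl mulr_sumr; congr (_ *~ _); apply: eq_big_seq => w.
by rewrite mem_gsupp => gw; rewrite h // mulrzAr.
Qed.

Lemma gcoefM_neq0 f g v : (f * g) v != 0 ->
  exists u w, [/\ f u != 0, g w != 0 & v = u + w].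
Proof.
move/(@mulGR_supp f g); rewrite mem_undup => /allpairsP[[u w] /= [fu gw ->]].
by exists u, w; rewrite -!mem_gsupp.
Qed.

Lemma gcoefM_single f g a b :
  (forall u w, f u != 0 -> g w != 0 -> u + w = a + b -> u = a /\ w = b) ->
  (f * g) (a + b) = f a * g b.
Proof.
move=> h; rewrite gcoefM mulGRE.
have z u : u != a -> f u != 0 -> f u * g (a + b - u) = 0.
  move=> ua fu; case: (eqVneq (g (a + b - u)) 0) => [->|gu]; first by rewrite mulr0.
  by case: (h _ _ fu gu); rewrite ?[u + _]addrC ?subrK // => e; rewrite e eqxx in ua.
case: (boolP (a \in gsupp f)) => fa.
  rewrite (bigD1_seq a) ?gsupp_uniq //= big1_seq ?addr0 ?[a + b]addrC ?addrK //.
  by move=> u /andP[ua]; rewrite mem_gsupp => fu; rewrite [b + a]addrC z.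
rewrite big1_seq; last first.
  move=> u /= fu; apply: z; last by rewrite -mem_gsupp.
  by apply: contraNneq fa => <-.
by move: fa; rewrite mem_gsupp negbK => /eqP ->; rewrite mul0r.
Qed.

(* Lexicographic positivity makes V a totally ordered group, so that leading terms multiply. *)
Definition lexpos v := [exists i, (0 < v 0 i) && [forall j : 'I_n, (j < i)%N ==> (v 0 j == 0)]].

Lemma lexposP v :
  reflect (exists i, 0 < v 0 i /\ forall j : 'I_n, (j < i)%N -> v 0 j = 0) (lexpos v).
Proof.
apply: (iffP existsP) => -[i].
  by case/andP=> vi /forallP h; exists i; split=> // j ji; apply/eqP; have := h j; rewrite ji.
by case=> vi h; exists i; rewrite vi; apply/forallP => j; apply/implyP => /h ->.
Qed.

Lemma lexposD v w : lexpos v -> lexpos w -> lexpos (v + w).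
Proof.
move=> /lexposP[i [vi hv]] /lexposP[j [wj hw]]; apply/lexposP.
case: (ltngtP i j) => ij.
- exists i; rewrite mxE hw // addr0; split=> // k ki.
  by rewrite mxE hv // hw ?addr0 // (ltn_trans ki).
- exists j; rewrite mxE hv // add0r; split=> // k ki.
  by rewrite mxE hw // hv ?addr0 // (ltn_trans ki).
- have {}ij : i = j by apply: val_inj.
  subst j; exists i; rewrite mxE addr_gt0 //; split=> // k ki.
  by rewrite mxE hw // hv ?addr0.
Qed.

Lemma lexpos0 : lexpos 0 = false.
Proof. by apply/lexposP => -[i []]; rewrite mxE ltxx. Qed.

Lemma lexpos_total v : v != 0 -> lexpos v || lexpos (- v).
Proof.
move=> v0; have [i0 vi0] : exists i, v 0 i != 0.
  apply/existsP; apply: contraR v0; rewrite negb_exists => /forallP h.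
  by apply/eqP/rowP => i; rewrite mxE; apply/eqP; have := h i; rewrite negbK.
case: (@arg_minnP _ i0 (fun i => v 0 i != 0) val vi0) => i vi hi.
have h0 (j : 'I_n) : (j < i)%N -> v 0 j = 0.
  by move=> ji; apply/eqP; apply: contraTT ji => /hi; rewrite -leqNgt.
case: (ltrP 0 (v 0 i)) => [vp|vn]; apply/orP.
  by left; apply/lexposP; exists i.
right; apply/lexposP; exists i; rewrite mxE oppr_gt0 lt_neqAle vi vn; split=> // j /h0.
by rewrite mxE => ->; rewrite oppr0.
Qed.

Lemma seq_lexmax (s : seq V) : s != [::] ->
  exists2 a, a \in s & forall v, v \in s -> v != a -> lexpos (a - v).
Proof.
elim: s => // x s IH _; case: (eqVneq s [::]) => [->|/IH[a sa ha]].
  by exists x; rewrite ?mem_head // => v; rewrite inE => /eqP ->; rewrite eqxx.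
case: (eqVneq x a) => [->|xa].
  by exists a; rewrite ?mem_head // => v; rewrite inE => /orP[/eqP ->|/ha //]; rewrite eqxx.
have /lexpos_total/orP[px|px] : x - a != 0 by rewrite subr_eq0.
  exists x; rewrite ?mem_head // => v; rewrite inE => /orP[/eqP ->|vs _]; first by rewrite eqxx.
  case: (eqVneq v a) => [-> //|va].
  by rewrite -(subrKA a) lexposD // ha.
exists a; first by rewrite inE sa orbT.
move=> v; rewrite inE => /orP[/eqP -> _|/ha //]; by rewrite -opprB.
Qed.

Lemma ga_lexlead f : f != 0 ->
  exists2 a, f a != 0 & forall v, f v != 0 -> v != a -> lexpos (a - v).
Proof.
move=> f0; have /seq_lexmax[a fa ha] : gsupp f != [::].
  apply: contra_neq f0 => e; apply/ga_ext/funext => v; apply/eqP.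
  by apply: contraT; rewrite -mem_gsupp e.
exists a; first by rewrite -mem_gsupp.
by move=> v; rewrite -mem_gsupp; apply: ha.
Qed.

(** The differences [a - u] and [b - w] are opposite to each other, and each is zero or
    lexicographically positive; so both vanish. *)
Lemma lexlead_sum a b u w : (u != a -> lexpos (a - u)) -> (w != b -> lexpos (b - w)) ->
  u + w = a + b -> u = a /\ w = b.
Proof.
move=> hu hw e; have e2 : b - w = - (a - u).
  by apply/eqP; rewrite -addr_eq0 addrACA [b + a]addrC -e -opprD [w + u]addrC subrr.
case: (eqVneq u a) => [ua|/hu pu]; last first.
  have : lexpos (b - w + (a - u)).
    case: (eqVneq w b) => [wb|/hw pw]; last exact: lexposD.
    by move: e2; rewrite wb subrr add0r.
  by rewrite e2 addNr lexpos0.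
by split=> //; move: e; rewrite ua => /addrI.
Qed.

Lemma ga_mul_neq0 f g : f != 0 -> g != 0 -> f * g != 0.
Proof.
move=> /ga_lexlead[a fa ha] /ga_lexlead[b gb hb].
apply/eqP => /(congr1 (fun h : ga => h (a + b))); rewrite gcoef0 gcoefM_single.
  by apply/eqP; rewrite mulf_neq0.
move=> u w fu gw; apply: lexlead_sum; [exact: ha|exact: hb].
Qed.

Lemma ga_mulfI f g h : f != 0 -> f * g = f * h -> g = h.
Proof.
move=> f0 /eqP; rewrite -subr_eq0 -mulrBr; apply: contraTeq => gh.
by rewrite ga_mul_neq0 // subr_eq0.
Qed.

Lemma ga_lexlow f : f != 0 ->
  exists2 a, f a != 0 & forall v, f v != 0 -> v != a -> lexpos (v - a).
Proof.
move=> f0; have /seq_lexmax[a fa ha] : [seq - v | v <- gsupp f] != [::].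
  apply: contra_neq f0 => e; apply/ga_ext/funext => v; apply/eqP.
  apply: contraT; rewrite -mem_gsupp; case: (gsupp f) e => //.
exists (- a); first by case/mapP: fa => v fv ->; rewrite opprK -mem_gsupp.
move=> v fv va; rewrite addrC opprK -[v]opprK ha //; last by rewrite eqr_oppLR.
by rewrite map_f // mem_gsupp.
Qed.

(** The products of the two highest and of the two lowest terms both survive in [f * g], hence both
    sit at exponent 0. So the highest exponent of [f] is also its lowest one, and its coefficient is
    a unit of the integers. *)
Lemma ga_unit f g : f * g = 1 -> exists v (k : int), (k = 1 \/ k = -1) /\ f = mono v *~ k.
Proof.
move=> fg; have f0 : f != 0.
  by apply/eqP => f0; move: fg; rewrite f0 mul0r => /esym/eqP; rewrite oner_eq0.
have g0 : g != 0.
  by apply/eqP => g0; move: fg; rewrite g0 mulr0 => /esym/eqP; rewrite oner_eq0.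
have [a fa ha] := ga_lexlead f0; have [b gb hb] := ga_lexlead g0.
have [c fc hc] := ga_lexlow f0; have [d gd hd] := ga_lexlow g0.
have eab : f a * g b = (a + b == 0)%:R.
  rewrite -gcoef1 -fg gcoefM_single // => u w fu gw.
  by apply: lexlead_sum; [exact: ha|exact: hb].
have ecd : f c * g d = (c + d == 0)%:R.
  rewrite -gcoef1 -fg gcoefM_single // => u w fu gw e.
  have [] : - u = - c /\ - w = - d.
    apply: lexlead_sum; last by rewrite -!opprD e.
      by rewrite eqr_opp => uc; rewrite opprK addrC hc.
    by rewrite eqr_opp => uc; rewrite opprK addrC hd.
  by move=> /oppr_inj -> /oppr_inj ->.
have ab : a + b = 0.
  by apply/eqP; apply: contraT => /negPf h; move/eqP: eab; rewrite h mulf_eq0 (negPf fa) (negPf gb).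
have cd : c + d = 0.
  by apply/eqP; apply: contraT => /negPf h; move/eqP: ecd; rewrite h mulf_eq0 (negPf fc) (negPf gd).
have ac : c = a.
  have [] // := @lexlead_sum a b c d (ha c fc) (hb d gd); by rewrite ab cd.
subst c; exists a, (f a); split; last first.
  apply/ga_ext/funext => v; rewrite gcoefMz gcoef_mono.
  case: (eqVneq v a) => [->|va]; first by rewrite -mulrzr mul1r intz.
  rewrite mul0rz; apply/eqP; apply: contraT => fv.
  have := lexposD (ha v fv va) (hc v fv va).
  by rewrite addrA subrK subrr lexpos0.
move: eab; rewrite ab eqxx => e.
have : f a \is a GRing.unit by apply/unitrP; exists (g b); rewrite mulrC e.
by move=> /orP[] /eqP; [left|right].
Qed.

End GroupAlgebra.

(** * Reflections *)

Section Euclidean.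
Variables (R : realType) (n : nat).
Local Notation V := 'rV[R]_n.
Implicit Types (a b u v w : V).

Lemma dotE u v : dot u v = \sum_i u 0 i * v 0 i.
Proof. by rewrite /dot mxE; apply: eq_bigr => i _; rewrite mxE. Qed.
Lemma dotC u v : dot u v = dot v u.
Proof. by rewrite !dotE; apply: eq_bigr => i _; rewrite mulrC. Qed.
Lemma dotDl u v w : dot (u + v) w = dot u w + dot v w.
Proof. by rewrite /dot mulmxDl mxE. Qed.
Lemma dotZl k u v : dot (k *: u) v = k * dot u v.
Proof. by rewrite /dot -scalemxAl mxE. Qed.
Lemma dotDr u v w : dot u (v + w) = dot u v + dot u w.
Proof. by rewrite !(dotC u) dotDl. Qed.
Lemma dotZr k u v : dot u (k *: v) = k * dot u v.
Proof. by rewrite !(dotC u) dotZl. Qed.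
Lemma dotNl u v : dot (- u) v = - dot u v.
Proof. by rewrite -scaleN1r dotZl mulN1r. Qed.
Lemma dotNr u v : dot u (- v) = - dot u v.
Proof. by rewrite !(dotC u) dotNl. Qed.
Lemma dotBl u v w : dot (u - v) w = dot u w - dot v w.
Proof. by rewrite dotDl dotNl. Qed.
Lemma dotBr u v w : dot u (v - w) = dot u v - dot u w.
Proof. by rewrite dotDr dotNr. Qed.
Lemma dot0l v : dot 0 v = 0.
Proof. by rewrite -(scale0r v) dotZl mul0r. Qed.
Lemma dot_suml (I : Type) (r : seq I) (P : pred I) (F : I -> V) v :
  dot (\sum_(i <- r | P i) F i) v = \sum_(i <- r | P i) dot (F i) v.
Proof. by elim/big_rec2: _ => [|i x y _ <-]; rewrite ?dot0l ?dotDl. Qed.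
Lemma dot_sumr (I : Type) (r : seq I) (P : pred I) (F : I -> V) v :
  dot v (\sum_(i <- r | P i) F i) = \sum_(i <- r | P i) dot v (F i).
Proof. by rewrite dotC dot_suml; apply: eq_bigr => i _; rewrite dotC. Qed.
Lemma dot_ge0 v : 0 <= dot v v.
Proof. by rewrite dotE sumr_ge0 // => i _; rewrite -expr2 sqr_ge0. Qed.
Lemma dot_eq0 v : (dot v v == 0) = (v == 0).
Proof.
apply/idP/eqP => [|->]; last by rewrite dot0l.
rewrite dotE psumr_eq0 => [|i _]; last by rewrite -expr2 sqr_ge0.
move=> /allP h; apply/rowP => i; rewrite mxE; apply/eqP.
by have := h i (mem_index_enum i); rewrite mulf_eq0 orbb.
Qed.
Lemma dot_gt0 v : v != 0 -> 0 < dot v v.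
Proof. by move=> v0; rewrite lt_neqAle eq_sym dot_eq0 v0 dot_ge0. Qed.

Lemma cpairD a u v : cpair a (u + v) = cpair a u + cpair a v.
Proof. by rewrite /cpair dotDr mulrDr mulrDl. Qed.
Lemma cpairZ a k v : cpair a (k *: v) = k * cpair a v.
Proof. by rewrite /cpair dotZr mulrCA -!mulrA. Qed.
Lemma cpairN a v : cpair a (- v) = - cpair a v.
Proof. by rewrite -scaleN1r cpairZ mulN1r. Qed.
Lemma cpairB a u v : cpair a (u - v) = cpair a u - cpair a v.
Proof. by rewrite cpairD cpairN. Qed.
Lemma cpair0 a : cpair a 0 = 0.
Proof. by rewrite -(scale0r 0) cpairZ mul0r. Qed.
Lemma cpair_sum (I : Type) (r : seq I) (P : pred I) (F : I -> V) a :
  cpair a (\sum_(i <- r | P i) F i) = \sum_(i <- r | P i) cpair a (F i).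
Proof. by elim/big_rec2: _ => [|i x y _ <-]; rewrite ?cpair0 ?cpairD. Qed.
Lemma cpairaa a : a != 0 -> cpair a a = 2.
Proof. by move=> a0; rewrite /cpair mulfK // dot_eq0. Qed.

Lemma reflE a v : v *m refl_mx a = v - cpair a v *: a.
Proof.
rewrite /refl_mx mulmxBr mulmx1 -scalemxAr mulmxA [v *m a^T]mx11_scalar -/(dot v a).
by rewrite mul_scalar_mx scalerA /cpair dotC mulrAC.
Qed.

Lemma refl_self a : a != 0 -> a *m refl_mx a = - a.
Proof. by move=> a0; rewrite reflE cpairaa // scaler_nat mulr2n opprD addrA subrr sub0r. Qed.

Lemma dot_cpair a v : a != 0 -> dot a v = cpair a v * dot a a / 2.
Proof.
move=> a0; rewrite /cpair divfK ?dot_eq0 // mulrC mulrA mulVf ?mul1r //.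
by rewrite pnatr_eq0.
Qed.

Lemma refl_tr a : (refl_mx a)^T = refl_mx a.
Proof. by rewrite /refl_mx linearB /= linearZ /= trmx1 trmx_mul trmxK. Qed.

Lemma row_mulP (m : nat) (M N : 'M[R]_(n, m)) : (forall v : V, v *m M = v *m N) -> M = N.
Proof. by move=> h; apply/row_matrixP => i; rewrite !rowE h. Qed.

Lemma refl_invol a : a != 0 -> refl_mx a *m refl_mx a = 1%:M.
Proof.
move=> a0; apply: row_mulP => v; rewrite mulmxA mulmx1 !reflE cpairB cpairZ cpairaa //.
by rewrite mulr_natr mulr2n opprD addrA subrr sub0r scaleNr opprK subrK.
Qed.

Lemma reflN a : refl_mx (- a) = refl_mx a.
Proof.
apply: row_mulP => v; rewrite !reflE /cpair !dotNl dotNr opprK.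
by rewrite mulrN mulNr scalerN scaleNr opprK.
Qed.

(** The identity [e1] factors one block matrix in two ways, so that the determinant of a rank-one
    perturbation of the identity is the scalar [1 - k * dot a a], with [k * dot a a = 2]. *)
Lemma det_refl a : a != 0 -> \det (refl_mx a) = -1.
Proof.
move=> a0; set k := 2 / dot a a.
have e1 : block_mx (1%:M : 'M_1) 0 (k *: a^T) (1%:M : 'M_n) *m
          block_mx (1%:M : 'M_1) a 0 (refl_mx a) =
          block_mx (1%:M : 'M_1) a 0 (1%:M : 'M_n) *m
          block_mx (1%:M - k *: (a *m a^T) : 'M_1) 0 (k *: a^T) (1%:M : 'M_n).
  rewrite !mulmx_block !(mulmx1, mul1mx, mul0mx, mulmx0, addr0, add0r).
  by rewrite /refl_mx -/k -scalemxAl -scalemxAr addrCA subrr addr0 subrK.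
have := congr1 determinant e1.
rewrite !det_mulmx !det_lblock !det_ublock !det1 !mul1r !mulr1 => ->.
rewrite [a *m a^T]mx11_scalar -/(dot a a) scale_scalar_mx /k divfK ?dot_eq0 //.
by rewrite -raddfB /= det_scalar1; ring.
Qed.

Definition isomx (w : 'M[R]_n) := w *m w^T = 1%:M.

Lemma isomx_tr (w : 'M[R]_n) : isomx w -> w^T *m w = 1%:M.
Proof. exact: mulmx1C. Qed.

Lemma dot_ortho (w : 'M[R]_n) u v : isomx w -> dot (u *m w) (v *m w) = dot u v.
Proof. by move=> ow; rewrite /dot trmx_mul mulmxA -(mulmxA u) ow mulmx1. Qed.

Lemma dot_trmx (w : 'M[R]_n) u v : dot (u *m w) v = dot u (v *m w^T).
Proof. by rewrite /dot trmx_mul trmxK mulmxA. Qed.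

Lemma cpair_ortho (w : 'M[R]_n) a v : isomx w -> cpair (a *m w) (v *m w) = cpair a v.
Proof. by move=> ow; rewrite /cpair !dot_ortho. Qed.

Lemma refl_conj (w : 'M[R]_n) a : isomx w ->
  refl_mx (a *m w) = w^T *m refl_mx a *m w.
Proof.
move=> ow; have wo := isomx_tr ow; rewrite /refl_mx dot_ortho // trmx_mul.
by rewrite mulmxBr mulmx1 mulmxBl wo -scalemxAr -scalemxAl !mulmxA.
Qed.

Lemma ortho_refl a : a != 0 -> isomx (refl_mx a).
Proof. by move=> a0; rewrite /isomx refl_tr refl_invol. Qed.

Lemma ortho_mul (w1 w2 : 'M[R]_n) : isomx w1 -> isomx w2 -> isomx (w1 *m w2).
Proof. by move=> o1 o2; rewrite /isomx trmx_mul mulmxA -(mulmxA w1) o2 mulmx1. Qed.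

Lemma CauchySchwarz_strict a b : a != 0 -> (forall k, b <> k *: a) ->
  dot a b * dot a b < dot a a * dot b b.
Proof.
move=> a0 h; have : 0 < dot (b - (dot a b / dot a a) *: a) (b - (dot a b / dot a a) *: a).
  by apply: dot_gt0; rewrite subr_eq0; apply/eqP/h.
have p := dot_gt0 a0.
rewrite dotBl !dotBr !dotZl !dotZr (dotC b a).
have -> : dot b b - dot a b / dot a a * dot a b -
  (dot a b / dot a a * dot a b - dot a b / dot a a * (dot a b / dot a a * dot a a)) =
  (dot a a * dot b b - dot a b * dot a b) / dot a a by field; rewrite gt_eqF.
by rewrite pmulr_lgt0 ?invr_gt0 // subr_gt0.
Qed.

Lemma seq_max (T : eqType) (s : seq T) (F : T -> R) : s != [::] ->
  exists2 x, x \in s & forall y, y \in s -> F y <= F x.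
Proof.
elim: s => // x s IH _; case: (eqVneq s [::]) => [->|/IH[y ys hy]].
  by exists x; rewrite ?mem_head // => y; rewrite inE => /eqP ->.
case: (lerP (F x) (F y)) => xy.
  by exists y; rewrite ?inE ?ys ?orbT // => z; rewrite inE => /orP[/eqP ->|/hy].
exists x; rewrite ?mem_head // => z; rewrite inE => /orP[/eqP -> //|/hy h].
by rewrite (le_trans h) // ltW.
Qed.

Lemma prod_strict (T : eqType) (s : seq T) (F G : T -> R) :
  (forall x, x \in s -> 0 < F x <= G x) -> (exists2 x, x \in s & F x < G x) ->
  \prod_(x <- s) F x < \prod_(x <- s) G x.
Proof.
move=> h [x xs fg]; rewrite !(big_rem x xs) /=.
have h' y : y \in rem x s -> 0 < F y <= G y by move/mem_rem/h.
have p : 0 < \prod_(y <- rem x s) F y.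
  by rewrite big_seq prodr_gt0 // => y /h'/andP[].
have le : \prod_(y <- rem x s) F y <= \prod_(y <- rem x s) G y.
  rewrite !big_seq; apply: ler_prod => y /h'/andP[fy ->].
  by rewrite ltW.
rewrite (@lt_le_trans _ _ (G x * \prod_(y <- rem x s) F y)) //.
  by rewrite ltr_pM2r.
have /andP[fx _] := h x xs.
by rewrite ler_pM2l // (lt_trans fx).
Qed.

Lemma bigmaxP (s : seq V) (F : V -> R) x0 :
  [/\ forall b, b \in s -> F b <= \big[Num.max/x0]_(a <- s) F a,
      x0 <= \big[Num.max/x0]_(a <- s) F a &
      \big[Num.max/x0]_(a <- s) F a = x0 \/
      exists2 a, a \in s & \big[Num.max/x0]_(a <- s) F a = F a].
Proof.
elim: s => [|a s [IH1 IH2 IH3]]; first by rewrite big_nil; split=> //; left.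
rewrite big_cons; split=> [b||].
- by rewrite inE le_max => /orP[/eqP ->|/IH1 ->]; rewrite ?lexx ?orbT.
- by rewrite le_max IH2 orbT.
case: (lerP (F a) (\big[Num.max/x0]_(a <- s) F a)) => _.
  by case: IH3 => [|[b bs e]]; [left|right; exists b; rewrite // inE bs orbT].
by right; exists a; rewrite ?mem_head.
Qed.

Lemma bigminP (s : seq V) (F : V -> R) x0 :
  [/\ forall b, b \in s -> \big[Num.min/x0]_(a <- s) F a <= F b,
      \big[Num.min/x0]_(a <- s) F a <= x0 &
      \big[Num.min/x0]_(a <- s) F a = x0 \/
      exists2 a, a \in s & \big[Num.min/x0]_(a <- s) F a = F a].
Proof.
elim: s => [|a s [IH1 IH2 IH3]]; first by rewrite big_nil; split=> //; left.
rewrite big_cons; split=> [b||].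
- by rewrite inE ge_min => /orP[/eqP ->|/IH1 ->]; rewrite ?lexx ?orbT.
- by rewrite ge_min IH2 orbT.
case: (lerP (F a) (\big[Num.min/x0]_(a <- s) F a)) => _.
  by right; exists a; rewrite ?mem_head.
by case: IH3 => [|[b bs e]]; [left|right; exists b; rewrite // inE bs orbT].
Qed.

End Euclidean.

(** * Weyl group *)

Section WeylGroup.
Variables (R : realType) (n : nat) (Phi Delta : seq 'rV[R]_n).
Hypothesis HPD : simple_based_root_system Phi Delta.
Local Notation V := 'rV[R]_n.
Local Notation I := 'I_(size Delta).
Local Notation al i := (Delta`_(i : I)).
Local Notation s_ i := (refl_mx Delta`_(i : I)).
Implicit Types (a b u v lam mu : V) (w : 'M[R]_n) (i j : I).

Lemma root_neq0 a : a \in Phi -> a != 0.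
Proof. by case: HPD => -[h0 _ _ _ _] _ _; apply: contraTneq => ->. Qed.
Lemma root_refl a b : a \in Phi -> b \in Phi -> b *m refl_mx a \in Phi.
Proof. by case: HPD => -[_ _ h _ _] _ _; apply: h. Qed.
Lemma root_int a b : a \in Phi -> b \in Phi -> is_int (cpair a b).
Proof. by case: HPD => -[_ _ _ h _] _ _; apply: h. Qed.
Lemma root_prop a c : a \in Phi -> c *: a \in Phi -> c = 1 \/ c = -1.
Proof. by case: HPD => -[_ _ _ _ h] _ _; apply: h. Qed.
Lemma simple_root i : al i \in Phi.
Proof. by case: HPD => _ _ [h _ _ _]; apply/h/mem_nth. Qed.
Lemma simple_neq0 i : al i != 0.
Proof. exact/root_neq0/simple_root. Qed.
Lemma base_free : free Delta.
Proof. by case: HPD => _ _ []. Qed.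
Lemma rootN a : a \in Phi -> - a \in Phi.
Proof. by move=> aP; rewrite -refl_self ?root_neq0 // root_refl. Qed.

(** * Coordinates in the base and positive roots *)

Definition co i v : R := coord (in_tuple Delta) i v.

Lemma base_span v : v \in <<Delta>>%VS.
Proof.
case: HPD => -[_ hs _ _ _] _ [_ _ _ hb].
have : v \in <<Phi>>%VS by rewrite hs memvf.
apply/subvP/span_subvP => b /hb[c] h.
have m : \sum_i (c i)%:R *: al i \in <<Delta>>%VS.
  by apply: memv_suml => i _; apply: memvZ; apply/memv_span/mem_nth.
by case: h => ->; rewrite ?memvN.
Qed.

Lemma coE v : v = \sum_i co i v *: al i.
Proof. exact: (coord_span (X := in_tuple Delta) (base_span v)). Qed.
Lemma coD i u v : co i (u + v) = co i u + co i v. Proof. exact: linearD. Qed.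
Lemma coZ i k v : co i (k *: v) = k * co i v. Proof. exact: linearZ. Qed.
Lemma coN i v : co i (- v) = - co i v. Proof. exact: linearN. Qed.
Lemma coB i u v : co i (u - v) = co i u - co i v. Proof. exact: linearB. Qed.
Lemma co0 i : co i 0 = 0. Proof. exact: linear0. Qed.
Lemma co_al i j : co i (al j) = (i == j)%:R.
Proof. by rewrite eq_sym; apply: (coord_free (X := in_tuple Delta)); apply: base_free. Qed.
Lemma co_sum (J : Type) (r : seq J) (P : pred J) (F : J -> V) i :
  co i (\sum_(j <- r | P j) F j) = \sum_(j <- r | P j) co i (F j).
Proof. exact: linear_sum. Qed.
Lemma co_eq u v : (forall i, co i u = co i v) -> u = v.
Proof. by move=> h; rewrite [u]coE [v]coE; apply: eq_bigr => i _; rewrite h. Qed.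
Lemma co_comb (c : I -> R) i : co i (\sum_j c j *: al j) = c i.
Proof.
rewrite co_sum (bigD1 i) //= coZ co_al eqxx mulr1 big1 ?addr0 // => j /negPf ji.
by rewrite coZ co_al eq_sym ji mulr0.
Qed.

Definition cone v := [forall i, 0 <= co i v].

Lemma coneP v : reflect (forall i, 0 <= co i v) (cone v).
Proof. exact: forallP. Qed.
Lemma coneD u v : cone u -> cone v -> cone (u + v).
Proof. by move=> /coneP hu /coneP hv; apply/coneP => i; rewrite coD addr_ge0. Qed.
Lemma cone0 : cone 0.
Proof. by apply/coneP => i; rewrite co0. Qed.
Lemma coneZ k v : 0 <= k -> cone v -> cone (k *: v).
Proof. by move=> k0 /coneP hv; apply/coneP => i; rewrite coZ mulr_ge0. Qed.
Lemma cone_al i : cone (al i).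
Proof. by apply/coneP => j; rewrite co_al ler0n. Qed.
Lemma cone_sum (J : Type) (r : seq J) (P : pred J) (F : J -> V) :
  (forall k : J, P k -> cone (F k)) -> cone (\sum_(k <- r | P k) F k).
Proof. by move=> h; elim/big_rec: _ => [|j x Pj]; [exact: cone0|apply/coneD/h]. Qed.
Lemma cone_anti v : cone v -> cone (- v) -> v = 0.
Proof.
move=> /coneP h1 /coneP h2; apply: co_eq => i; rewrite co0; apply/le_anti.
by rewrite h1 andbT -oppr_ge0 -coN h2.
Qed.

Lemma root_cone b : b \in Phi -> cone b || cone (- b).
Proof.
case: HPD => _ _ [_ _ _ h] /h [c hc]; apply/orP.
case: hc => ->; [left|right; rewrite opprK]; apply: cone_sum => i _;
  by rewrite coneZ ?cone_al // ler0n.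
Qed.

(** The list [Phi] may repeat a root, whereas products over [Pos] must count each positive root
    once. *)
Definition Pos : seq V := undup [seq b <- Phi | cone b].

Lemma mem_Pos b : (b \in Pos) = (cone b) && (b \in Phi).
Proof. by rewrite mem_undup mem_filter. Qed.
Lemma Pos_root b : b \in Pos -> b \in Phi.
Proof. by rewrite mem_Pos => /andP[]. Qed.
Lemma Pos_cone b : b \in Pos -> cone b.
Proof. by rewrite mem_Pos => /andP[]. Qed.
Lemma al_Pos i : al i \in Pos.
Proof. by rewrite mem_Pos cone_al simple_root. Qed.
Lemma PosN b : b \in Phi -> (- b \in Pos) = (b \notin Pos).
Proof.
move=> bP; rewrite !mem_Pos rootN // bP !andbT.
have := root_cone bP; case: (boolP (cone b)) => //= cb _; apply/negP => cn.
by have := root_neq0 bP; rewrite (cone_anti cb cn) eqxx.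
Qed.

Lemma co_refl i j v : i != j -> co j (v *m s_ i) = co j v.
Proof. by move=> /negPf ij; rewrite reflE coB coZ co_al eq_sym ij mulr0 subr0. Qed.

(** Only the [i]-th coordinate changes under [s_i]. A positive root other than [al i] is not
    proportional to it, so another coordinate is positive and stays so, which decides the sign of
    the image. *)
Lemma Pos_refl i b : b \in Pos -> b != al i -> b *m s_ i \in Pos.
Proof.
move=> bP bi; have bR := Pos_root bP; have /coneP cb := Pos_cone bP.
have sR : b *m s_ i \in Phi by rewrite root_refl ?simple_root.
rewrite mem_Pos sR andbT.
have [j ij bj] : exists2 j, i != j & 0 < co j b.
  apply/exists_inP; apply: contraNT bi; rewrite negb_exists_in => /forall_inP h.
  have e : b = co i b *: al i.
    rewrite {1}[b]coE (bigD1 i) //= big1 ?addr0 // => j; rewrite eq_sym => /h.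
    by rewrite lt_neqAle cb andbT negbK => /eqP <-; rewrite scale0r.
  have : co i b *: al i \in Phi by rewrite -e.
  case/(root_prop (simple_root i)) => h1; first by rewrite e h1 scale1r.
  by have := cb i; rewrite h1; lra.
have := root_cone sR; case: (cone _) => //= /coneP/(_ j).
by rewrite coN co_refl //; lra.
Qed.

Lemma Pos_refl_perm i : perm_eq [seq b *m s_ i | b <- rem (al i) Pos] (rem (al i) Pos).
Proof.
have inv b : b *m s_ i *m s_ i = b by rewrite -mulmxA refl_invol ?mulmx1 ?simple_neq0.
have inj : injective (fun b : V => b *m s_ i) by apply: (can_inj (g := fun b => b *m s_ i)).
have uP : uniq Pos by apply: undup_uniq.
have sub b : b \in rem (al i) Pos -> b *m s_ i \in rem (al i) Pos.
  rewrite !mem_rem_uniq // !inE => /andP[bi bP]; rewrite Pos_refl // andbT.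
  apply: contraTneq bP => e; have := inv b; rewrite e refl_self ?simple_neq0 // => <-.
  by rewrite PosN ?simple_root // al_Pos.
apply: uniq_perm; rewrite ?map_inj_uniq ?rem_uniq // => b.
apply/mapP/idP => [[c /sub h -> //]|bP]; exists (b *m s_ i); rewrite ?sub //.
Qed.

Lemma inW_mul w1 w2 : inW Phi w1 -> inW Phi w2 -> inW Phi (w1 *m w2).
Proof.
move=> h1; elim=> [|w a hw IH aP]; first by rewrite mulmx1.
by rewrite mulmxA; apply: inWr.
Qed.
Lemma inW_refl a : a \in Phi -> inW Phi (refl_mx a).
Proof. by move=> aP; rewrite -[refl_mx a]mul1mx; apply: inWr => //; apply: inW1. Qed.
Lemma inW_tr w : inW Phi w -> inW Phi w^T.
Proof.
elim=> [|{}w a _ IH aP]; first by rewrite trmx1; apply: inW1.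
by rewrite trmx_mul refl_tr; apply: inW_mul => //; apply: inW_refl.
Qed.
Lemma inW_ortho w : inW Phi w -> isomx w.
Proof.
elim=> [|{}w a _ IH aP]; first by rewrite /isomx trmx1 mulmx1.
by apply: ortho_mul => //; apply/ortho_refl/root_neq0.
Qed.
Lemma inW_root w b : inW Phi w -> b \in Phi -> b *m w \in Phi.
Proof.
move=> hw bP; elim: hw => [|{}w a _ IH aP]; first by rewrite mulmx1.
by rewrite mulmxA root_refl.
Qed.
Lemma inW_mulK w v : inW Phi w -> v *m w *m w^T = v.
Proof. by move=> /inW_ortho ow; rewrite -mulmxA ow mulmx1. Qed.
Lemma inW_mulVK w v : inW Phi w -> v *m w^T *m w = v.
Proof. by move=> /inW_ortho/isomx_tr ow; rewrite -mulmxA ow mulmx1. Qed.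
Lemma inW_dot w u v : inW Phi w -> dot (u *m w) (v *m w) = dot u v.
Proof. by move=> /inW_ortho; apply: dot_ortho. Qed.

(** * Words in the simple reflections *)

Local Notation word := (word_mx (Delta := Delta)).

Lemma word_cat s t : word (s ++ t) = word s *m word t.
Proof. by elim: s => [|i s IH] /=; rewrite ?mul1mx // IH mulmxA. Qed.
Lemma word_rcons s i : word (rcons s i) = word s *m s_ i.
Proof. by rewrite -cats1 word_cat /= mulmx1. Qed.
Lemma word_inW s : inW Phi (word s).
Proof.
elim: s => [|i s IH] /=; first exact: inW1.
by apply: inW_mul IH; apply/inW_refl/simple_root.
Qed.
Lemma word_tr s : (word s)^T = word (rev s).
Proof.
elim: s => [|i s IH]; first by rewrite trmx1.
by rewrite /= trmx_mul refl_tr IH rev_cons word_rcons.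
Qed.

Definition height v := \sum_i co i v.

(** By induction on the height: as [dot a a] is positive, some simple root pairs positively with
    [a], and its reflection lowers the height by a positive integer while keeping [a] positive
    unless [a] is that simple root. *)
Lemma Pos_conj_simple (N : nat) a : a \in Pos -> height a <= N%:R ->
  exists i s, a = al i *m word s.
Proof.
elim: N a => [|N IH] a aP hN; have /coneP ca := Pos_cone aP;
    have a0 := root_neq0 (Pos_root aP).
  have h0 : height a == 0 by rewrite eq_le hN sumr_ge0.
  case/negP: a0; apply/eqP; apply: co_eq => i; rewrite co0; apply/eqP.
  by move: h0; rewrite psumr_eq0 // => /allP/(_ i (mem_index_enum i)).
case: (boolP [exists i, a == al i]) => [/existsP[i /eqP ->]|/existsPn nsim].
  by exists i, [::]; rewrite /= mulmx1.
have [i di] : exists i, 0 < dot (al i) a.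
  apply/existsP; apply: contraT; rewrite negb_exists => /forallP h.
  have := dot_gt0 a0; rewrite {1}[a]coE dot_suml ltNge sumr_le0 // => i _.
  by rewrite dotZl mulr_ge0_le0 // leNgt h.
have bP : a *m s_ i \in Pos by apply: Pos_refl.
have [|j [s e]] := IH _ bP; last first.
  exists j, (rcons s i); rewrite word_rcons mulmxA -e -mulmxA refl_invol ?mulmx1 //.
  exact: simple_neq0.
have [z ez] := root_int (simple_root i) (Pos_root aP).
have zp : 0 < cpair (al i) a.
  by rewrite /cpair divr_gt0 ?dot_gt0 ?simple_neq0 // mulr_gt0.
rewrite reflE /height; under eq_bigr => j _ do rewrite coB coZ co_al.
rewrite sumrB (bigD1 i) //= [X in _ - X](bigD1 i) //= [X in _ - (_ + X)]big1 ?addr0; last first.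
  by move=> j /negPf ->; rewrite mulr0.
rewrite -(bigD1 (P := predT) i) //= -/(height a) eqxx mulr1 ez.
move: zp; rewrite ez ltr0z gtz0_ge1 -(ler1z R) => z1.
by move: hN; rewrite -natr1; lra.
Qed.

Lemma refl_word a : a \in Phi -> exists s, refl_mx a = word s.
Proof.
suff h b : b \in Pos -> exists s, refl_mx b = word s.
  move=> aP; case: (boolP (a \in Pos)) => [/h //|].
  by rewrite -PosN // => /h; rewrite reflN.
move=> bP; have [N hN] : exists N : nat, height b <= N%:R.
  exists (Num.truncn (height b)).+1; apply/ltW/truncnS_gt.
have [i [s ->]] := Pos_conj_simple bP hN.
exists (rev s ++ i :: s); rewrite refl_conj; last exact/inW_ortho/word_inW.
by rewrite word_cat word_tr /= mulmxA.
Qed.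

Lemma inW_word w : inW Phi w -> exists s, word s = w.
Proof.
elim=> [|{}w a _ [s <-] /refl_word[t ->]]; first by exists [::].
by exists (s ++ t); rewrite word_cat.
Qed.

Lemma det_word s : \det (word s) = (-1) ^+ size s.
Proof.
elim: s => [|i s IH] /=; first by rewrite det1.
by rewrite det_mulmx det_refl ?simple_neq0 // IH exprS.
Qed.

(** Every simple reflection has determinant -1, so the parity of a word depends only on its product.
    This is what makes [eps] multiplicative. *)
Lemma eps_det w : inW Phi w -> (eps Delta w)%:~R = \det w.
Proof.
move=> hw; rewrite /eps /wlength.
pose P k := `[< exists s : seq I, size s = k /\ word s = w >].
have exP : exists k, P k.
  by have [s e] := inW_word hw; exists (size s); apply/asboolP; exists s.
(* The set of minimal word lengths is inhabited, so the default 0 of [wlength] is never taken. *)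
case: xgetP => [k -> /= [[s [<- <-]] _]|/(_ (ex_minn exP))]; last first.
  case: ex_minnP => k /asboolP pk hk; case; split=> // s sw; apply: hk.
  by apply/asboolP; exists s.
by rewrite det_word rmorphXn /= rmorphN1.
Qed.

Lemma epsM w1 w2 : inW Phi w1 -> inW Phi w2 ->
  eps Delta (w1 *m w2) = eps Delta w1 * eps Delta w2.
Proof.
move=> h1 h2; apply: (@intr_inj R).
by rewrite rmorphM /= !eps_det ?det_mulmx //; apply: inW_mul.
Qed.
Lemma eps1 : eps Delta (1%:M : 'M[R]_n) = 1.
Proof. by apply: (@intr_inj R); rewrite eps_det ?det1 //; apply: inW1. Qed.
Lemma eps_refl a : a \in Phi -> eps Delta (refl_mx a) = -1.
Proof.
move=> aP; apply: (@intr_inj R).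
by rewrite eps_det ?det_refl ?root_neq0 ?rmorphN1 //; apply: inW_refl.
Qed.
Lemma eps_tr w : inW Phi w -> eps Delta w^T = eps Delta w.
Proof.
by move=> hw; apply: (@intr_inj R); rewrite !eps_det ?det_tr //; apply: inW_tr.
Qed.
Lemma eps_neq0 w : eps Delta w != 0.
Proof. by rewrite /eps expf_neq0. Qed.

(** The exchange condition. The only positive root made negative by [s_j] is [al j]; hence, at the
    letter where the image of [al i] turns negative, the image just before is the simple root of
    that letter, and multiplication by [s_i] on the left deletes the letter. *)
Lemma word_exchange i s : al i *m word s \notin Pos ->
  exists2 s', (size s' < size s)%N & s_ i *m word s = word s'.
Proof.
elim/last_ind: s => [|s j IH]; first by rewrite /= mulmx1 al_Pos.
rewrite word_rcons mulmxA size_rcons => h.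
case: (boolP (al i *m word s \in Pos)) => [aP|/IH [s' hs e]]; last first.
  by exists (rcons s' j); rewrite ?size_rcons // word_rcons mulmxA e.
exists s => //; have e : al i *m word s = al j.
  by apply/eqP; apply: contraNT h; apply: Pos_refl.
have ow := inW_ortho (word_inW s).
rewrite mulmxA -e refl_conj // !mulmxA -(mulmxA _ (word s)) ow mulmx1.
by rewrite refl_invol ?simple_neq0 // mul1mx.
Qed.

(** The first letter of a nonempty word changes the sign of its own simple root, so the remaining
    letters must change it back, and the exchange condition gives a shorter word for the same
    element. *)
Lemma word_pos s : (forall b, b \in Pos -> b *m word s \in Pos) -> word s = 1%:M.
Proof.
have [N] := ubnP (size s); elim: N s => // N IH [//|i s] /ltnSE hN h.
have := h _ (al_Pos i); rewrite /= mulmxA refl_self ?simple_neq0 // mulNmx PosN.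
  case/word_exchange => s' hs e; rewrite e; apply: IH; first exact: (ltn_trans hs).
  by move=> b /h; rewrite /= e.
by rewrite inW_root ?simple_root //; apply: word_inW.
Qed.

(** * Dominance and the finite list of group elements *)

Definition sdom v := forall i, 0 < dot (al i) v.
Definition wdom v := forall i, 0 <= dot (al i) v.

Lemma sdom_wdom v : sdom v -> wdom v.
Proof. by move=> h i; apply/ltW/h. Qed.

Lemma cone_wdom u v : cone u -> wdom v -> 0 <= dot u v.
Proof.
move=> /coneP cu dv; rewrite [u]coE dot_suml sumr_ge0 // => i _.
by rewrite dotZl mulr_ge0.
Qed.

Lemma cone_sdom_eq0 u v : cone u -> sdom v -> dot u v <= 0 -> u = 0.
Proof.
move=> /coneP cu dv; rewrite {1}[u]coE dot_suml => h.
have p i : 0 <= dot (co i u *: al i) v by rewrite dotZl mulr_ge0 // ltW.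
have /eqP : \sum_i dot (co i u *: al i) v == 0 by rewrite eq_le h sumr_ge0.
move/eqP; rewrite psumr_eq0 // => /allP z.
apply: co_eq => i; rewrite co0; apply/eqP; have := z i (mem_index_enum i).
by rewrite /= dotZl mulf_eq0 [dot _ v == 0]gt_eqF ?orbF.
Qed.

Lemma cone_sdom u v : cone u -> sdom v -> u != 0 -> 0 < dot u v.
Proof.
move=> cu dv; apply: contraNT; rewrite -leNgt => h.
by apply/eqP; apply: cone_sdom_eq0 dv h.
Qed.

(** A positive root made negative by [w] would pair positively with [lam], whereas its image would
    pair negatively with [lam *m w]; but [w] preserves the pairing. *)
Lemma sdom_unique w lam : inW Phi w -> sdom lam -> sdom (lam *m w) -> w = 1%:M.
Proof.
move=> hw dl dw; have [s e] := inW_word hw; rewrite -e; apply: word_pos => b bP.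
rewrite e; have bw : b *m w \in Phi by rewrite inW_root // Pos_root.
apply: contraT; rewrite -PosN // => bn.
have h1 := cone_sdom (Pos_cone bn) dw (root_neq0 (Pos_root bn)).
have := cone_sdom (Pos_cone bP) dl (root_neq0 (Pos_root bP)).
by move: h1; rewrite dotNl inW_dot //; lra.
Qed.

Definition basemx : 'M[R]_(size Delta, n) := \matrix_i al i.

Lemma basemx_mul (u : 'rV[R]_(size Delta)) : u *m basemx = \sum_i u 0 i *: al i.
Proof. by rewrite mulmx_sum_row; apply: eq_bigr => i _; rewrite rowK. Qed.

Lemma basemx_free : row_free basemx.
Proof.
apply: inj_row_free => u; rewrite basemx_mul => h; apply/rowP => i.
by rewrite mxE -(co_comb (fun i => u 0 i) i) h co0.
Qed.

Lemma basemx_full : row_full basemx.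
Proof.
rewrite -sub1mx; apply/row_subP => i; rewrite [row i _]coE.
by apply: summx_sub => j _; apply: scalemx_sub; rewrite -(rowK (fun i => al i) j) row_sub.
Qed.

(** With all values 1 this gives a direction exposing a single vertex of the weight polytope; with
    value 0 at one simple root and 1 elsewhere, a direction exposing an edge. *)
Lemma dual_exists (t : I -> R) : exists v, forall i, dot (al i) v = t i.
Proof.
have : (\row_i t i <= basemx^T)%MS.
  by apply: submx_full; rewrite /row_full mxrank_tr; apply: basemx_free.
case/submxP => v e; exists v => i; have := congr1 (fun M : 'rV_(size Delta) => M 0 i) e.
rewrite mxE => ->; rewrite dotC dotE mxE; apply: eq_bigr => j _; rewrite !mxE //.
Qed.

Lemma cpair_exists (t : I -> R) : exists v, forall i, cpair (al i) v = t i.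
Proof.
have [v hv] := dual_exists (fun i => t i * dot (al i) (al i) / 2).
exists v => i; rewrite /cpair hv; field.
by rewrite dot_eq0 simple_neq0.
Qed.

Lemma cpair_eq u v : (forall i, cpair (al i) u = cpair (al i) v) -> u = v.
Proof.
move=> h; apply/eqP; rewrite -subr_eq0 -dot_eq0 {1}[u - v]coE dot_suml big1 // => i _.
by rewrite dotZl dot_cpair ?simple_neq0 // cpairB h subrr !mul0r mulr0.
Qed.

Lemma cpair_gt0 a v : a != 0 -> (0 < cpair a v) = (0 < dot a v).
Proof.
by move=> a0; rewrite (dot_cpair v a0) [RHS]pmulr_lgt0 ?invr_gt0 // [RHS]pmulr_lgt0 // dot_gt0.
Qed.

(** A group element is determined by the images of the simple roots, which lie in [Phi]; so it
    suffices to list all maps from the base to [Phi], recover a matrix from each, and filter. *)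
Definition Wl : seq 'M[R]_n := undup [seq w <- [seq pinvmx basemx *m
  (\matrix_(i < size Delta) Phi`_(f i)) | f : {ffun I -> 'I_(size Phi)}] | `[< inW Phi w >]].

Lemma WlP w : reflect (inW Phi w) (w \in Wl).
Proof.
rewrite mem_undup mem_filter; apply: (iffP andP) => [[/asboolP] //|hw].
split; first exact/asboolP.
have idx i : (index (al i *m w) Phi < size Phi)%N.
  by rewrite index_mem inW_root ?simple_root.
apply/mapP; exists [ffun i => Ordinal (idx i)]; first by rewrite mem_enum.
have -> : \matrix_(i < size Delta) Phi`_([ffun i => Ordinal (idx i)] i) = basemx *m w.
  apply/row_matrixP => i; rewrite rowK row_mul rowK ffunE /= nth_index //.
  by rewrite inW_root ?simple_root.
by rewrite mulmxA mulVpmx ?basemx_full // mul1mx.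
Qed.

Lemma Wl_uniq : uniq Wl.
Proof. exact: undup_uniq. Qed.

Lemma Wl_mulr_perm w : inW Phi w -> perm_eq [seq w' *m w | w' <- Wl] Wl.
Proof.
move=> hw; have ow := inW_ortho hw.
apply: uniq_perm; rewrite ?Wl_uniq ?map_inj_uniq ?Wl_uniq //.
  by apply: (can_inj (g := fun M => M *m w^T)) => M; rewrite -mulmxA ow mulmx1.
move=> M; apply/mapP/idP => [[w' /WlP h ->]|/WlP h]; first exact/WlP/inW_mul.
exists (M *m w^T); first by apply/WlP/inW_mul/inW_tr.
by rewrite -mulmxA isomx_tr // mulmx1.
Qed.

Lemma Wl_tr_perm : perm_eq [seq w^T | w <- Wl] Wl.
Proof.
apply: uniq_perm; rewrite ?Wl_uniq ?map_inj_uniq ?Wl_uniq //; first exact: trmx_inj.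
move=> M; apply/mapP/idP => [[w' /WlP h ->]|/WlP h]; first exact/WlP/inW_tr.
by exists M^T; rewrite ?trmxK //; apply/WlP/inW_tr.
Qed.

(** Among the conjugates of [v] that exceed it by an element of the cone, take one maximizing the
    pairing with a strictly dominant [h]. If it paired negatively with a simple root, the reflection
    would add a positive multiple of that root and increase the pairing. *)
Lemma dominant_conj v : exists2 w, inW Phi w & wdom (v *m w) /\ cone (v *m w - v).
Proof.
have [h hh] := dual_exists (fun=> 1).
have hd : sdom h by move=> i; rewrite hh.
pose s := [seq w <- Wl | cone (v *m w - v)].
have [|w] := @seq_max _ _ s (fun w => dot (v *m w) h).
  suff : 1%:M \in s by case: s.
  by rewrite mem_filter mulmx1 subrr cone0; apply/WlP/inW1.
rewrite mem_filter => /andP[cw /WlP hw] mx; exists w => //; split=> // i.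
rewrite leNgt; apply/negP => neg.
have cn : cpair (al i) (v *m w) < 0.
  rewrite /cpair pmulr_llt0 ?invr_gt0 ?dot_gt0 ?simple_neq0 // pmulr_rlt0 //.
have := mx (w *m s_ i); rewrite mem_filter mulmxA reflE dotBl dotZl hh mulr1.
have -> : w *m s_ i \in Wl by apply/WlP/inW_mul => //; apply/inW_refl/simple_root.
rewrite andbT addrAC -scaleNr coneD ?coneZ ?cone_al ?oppr_ge0 ?(ltW cn) //.
by move=> /(_ isT); lra.
Qed.

(** A dominant conjugate of [lam *m w] is orthogonal to no root, since [lam] is not; being strictly
    dominant it is [lam] itself, and it exceeds [lam *m w] by an element of the cone. *)
Lemma sdom_cone lam w : sdom lam -> inW Phi w -> cone (lam - lam *m w).
Proof.
move=> dl hw; have [w' hw' [dw cw]] := dominant_conj (lam *m w).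
have hww := inW_mul hw hw'; rewrite -mulmxA in dw cw.
suff e : w *m w' = 1%:M by rewrite e mulmx1 in cw.
apply: (sdom_unique hww dl) => i; rewrite lt_neqAle dw andbT eq_sym.
have r := inW_root (inW_tr hww) (simple_root i).
rewrite dotC dot_trmx dotC.
case: (boolP (al i *m (w *m w')^T \in Pos)) => [p|].
  by rewrite gt_eqF // cone_sdom ?(Pos_cone p) ?root_neq0.
rewrite -PosN // => p; rewrite -oppr_eq0 -dotNl gt_eqF //.
by rewrite cone_sdom ?(Pos_cone p) ?root_neq0 // Pos_root.
Qed.

(** * Alternating sums and their faces *)

Local Notation GA := (ga R n).
Implicit Types (f g : GA) (h : V).

Definition bnd h (c : R) f := forall v, f v != 0 -> dot v h <= c.

Lemma lev_fin h (c : R) f :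
  finite_set (supp ((fun v => if dot v h == c then f v else 0) : GR R n)).
Proof.
by apply: (@finite_supp _ _ _ (gsupp f)) => v; rewrite mem_gsupp; case: ifP; rewrite ?eqxx.
Qed.

(** At the largest level [c] reached by the support this is the part of [f] on the face of its
    Newton polytope exposed by [h], and passing to it is multiplicative. *)
Definition lev h c f : GA := Ga (lev_fin h c f).

Lemma levE h c f v : lev h c f v = if dot v h == c then f v else 0.
Proof. by []. Qed.

Lemma ev_lev (A : zmodType) h c f (phi : V -> A) :
  ev (lev h c f) phi = ev f (fun v => if dot v h == c then phi v else 0).
Proof.
rewrite (@ev_widen _ _ _ (gsupp f)) ?gsupp_uniq //; last first.
  by move=> v; rewrite levE mem_gsupp; case: ifP; rewrite ?eqxx.
by apply: eq_bigr => v _; rewrite levE; case: ifP; rewrite ?mul0rz.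
Qed.

Lemma lev_mul h c d f g : bnd h c f -> bnd h d g ->
  lev h (c + d) (f * g) = lev h c f * lev h d g.
Proof.
move=> bf bg; apply: ga_evP => phi; rewrite !(evM, ev_lev).
apply: eq_ev => v /bf hv; rewrite ev_lev; case: ifP => [/eqP e|ne]; last first.
  rewrite (@eq_ev _ _ _ g _ (fun=> 0)) ?/ev ?big1 // => [w _|w /bg hw]; first by rewrite mul0rz.
  rewrite dotDl; case: eqP => // e; move/eqP: ne; case.
  by apply/le_anti; rewrite hv /=; lra.
apply: eq_ev => w _; rewrite dotDl e; congr (if _ then _ else _).
by apply/eqP/eqP => [/addrI|->].
Qed.

Lemma bnd_mul h c d f g : bnd h c f -> bnd h d g -> bnd h (c + d) (f * g).
Proof.
by move=> bf bg v /gcoefM_neq0[u [w [/bf hu /bg hw ->]]]; rewrite dotDl lerD.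
Qed.

Lemma levD h c f g : lev h c (f + g) = lev h c f + lev h c g.
Proof.
by apply/ga_ext/funext => v; rewrite gcoefD !levE gcoefD; case: ifP; rewrite ?addr0.
Qed.
Lemma lev0 h c : lev h c 0 = 0.
Proof. by apply/ga_ext/funext => v; rewrite levE gcoef0; case: ifP. Qed.
Lemma lev_sum (J : Type) (r : seq J) (F : J -> GA) h c :
  lev h c (\sum_(k <- r) F k) = \sum_(k <- r) lev h c (F k).
Proof. by elim/big_rec2: _ => [|k x y _ <-]; rewrite ?lev0 ?levD. Qed.
Lemma lev_mono h c v (k : int) :
  lev h c (mono v *~ k) = if dot v h == c then mono v *~ k else 0.
Proof.
apply/ga_ext/funext => u; rewrite levE gcoefMz gcoef_mono.
case: (eqVneq u v) => [->|/negPf uv]; first by case: ifP; rewrite ?gcoefMz ?gcoef_mono ?eqxx.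
by rewrite mul0rz; case: ifP; case: ifP; rewrite ?gcoefMz ?gcoef_mono ?uv ?mul0rz.
Qed.
Lemma lev_mono1 h c v : lev h c (mono v) = if dot v h == c then mono v else 0.
Proof. by have := lev_mono h c v 1; rewrite !mulr1z. Qed.
Lemma bnd_mono h v : bnd h (dot v h) (mono v).
Proof. by move=> u; rewrite gcoef_mono; case: (eqVneq u v) => [->|]. Qed.
Lemma mono_neq0 v : mono v != 0 :> GA.
Proof. by apply/eqP => /(congr1 (fun f : GA => f v)); rewrite gcoef_mono eqxx gcoef0. Qed.

Definition istop h c f := bnd h c f /\ lev h c f != 0.

Lemma istop_neq0 h c f : istop h c f -> f != 0.
Proof. by case=> _; apply: contra_neq => ->; apply: lev0. Qed.
Lemma istop_coef h c f : istop h c f -> exists2 v, f v != 0 & dot v h = c.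
Proof.
case=> _ /ga_lexlead[v lv _]; move: lv; rewrite levE; case: ifP => [/eqP <-|]; last by rewrite eqxx.
by exists v.
Qed.
Lemma istop_uniq h c d f : istop h c f -> istop h d f -> c = d.
Proof.
move=> tc td; have [v fv ev] := istop_coef tc; have [u fu eu] := istop_coef td.
by apply/le_anti; rewrite -{1}ev td.1 //= -eu tc.1.
Qed.
Lemma istop_mul h c d f g : istop h c f -> istop h d g -> istop h (c + d) (f * g).
Proof.
move=> [bf lf] [bg lg]; split; first exact: bnd_mul.
by rewrite lev_mul // ga_mul_neq0.
Qed.
Lemma istop_exists h f : f != 0 -> exists c, istop h c f.
Proof.
move=> f0; have [a fa _] := ga_lexlead f0.
have [|v fv mx] := @seq_max _ _ (gsupp f) (fun v => dot v h).
  by move: fa; rewrite -mem_gsupp; case: (gsupp f).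
rewrite mem_gsupp in fv; exists (dot v h); split.
  by move=> u; rewrite -mem_gsupp; apply: mx.
by apply: contra_neq fv => /(congr1 (fun f : GA => f v)); rewrite levE eqxx.
Qed.

Definition Sg lam : GA := \sum_(w <- Wl) mono (lam *m w) *~ eps Delta w.

Lemma SgE lam : S Phi Delta lam = coef (Sg lam) :> (V -> int).
Proof.
apply/funext => mu; rewrite /S (fsbigE Wl) ?Wl_uniq //; first last.
- by move=> w hw; rewrite (introT (WlP w)).
- by move=> w /= /WlP.
rewrite /Sg gcoef_sum [LHS]big_mkcond; apply: eq_big_seq => w /WlP hw.
rewrite ifT ?inE // gcoefMz gcoef_mono eq_sym.
by case: eqP => _; rewrite ?mul0rz // -[LHS]intz.
Qed.

Definition antisym f := forall w v, inW Phi w -> f (v *m w) = eps Delta w * f v.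

Lemma Sg_antisym lam : antisym (Sg lam).
Proof.
move=> w v hw; rewrite /Sg !gcoef_sum -(perm_big _ (Wl_mulr_perm hw)) big_map mulr_sumr.
apply: eq_big_seq => w' /WlP hw'; rewrite !gcoefMz !gcoef_mono mulmxA epsM // mulrC.
rewrite (can_eq (g := fun u : V => u *m w^T) (fun u => inW_mulK u hw)).
by case: eqP => _; rewrite ?mul0rz ?mulr0 // -!/(_%:~R) !intz.
Qed.

Lemma sdom_stab lam w w' : sdom lam -> inW Phi w -> inW Phi w' ->
  lam *m w = lam *m w' -> w = w'.
Proof.
move=> dl hw hw' e; have : w *m w'^T = 1%:M.
  apply: (sdom_unique _ dl); first by apply/inW_mul/inW_tr.
  by rewrite mulmxA e inW_mulK.
move/(congr1 (mulmx^~ w')); rewrite mul1mx -mulmxA => <-.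
by rewrite (isomx_tr (inW_ortho hw')) mulmx1.
Qed.

Lemma Sg_supp lam v : Sg lam v != 0 -> exists2 w, inW Phi w & v = lam *m w.
Proof.
rewrite gcoef_sum => nz.
have [w /WlP hw /eqP ->] : exists2 w, w \in Wl & v == lam *m w; last by exists w.
apply/hasP; apply: contraNT nz => /hasPn nh; apply/eqP/big1_seq => w /= /nh.
by rewrite gcoefMz gcoef_mono => /negPf ->; rewrite mul0rz.
Qed.

Lemma Sg_bnd lam h : sdom lam -> wdom h -> bnd h (dot lam h) (Sg lam).
Proof.
move=> dl dh v /Sg_supp[w hw ->].
by rewrite -subr_ge0 -dotBl; apply: cone_wdom => //; apply: sdom_cone.
Qed.

Lemma Sg_lev lam h : lev h (dot lam h) (Sg lam) =
  \sum_(w <- Wl | dot (lam *m w) h == dot lam h) mono (lam *m w) *~ eps Delta w.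
Proof.
by rewrite lev_sum [RHS]big_mkcond; apply: eq_bigr => w _; rewrite lev_mono.
Qed.

Lemma Sg_lev_sdom lam h : sdom lam -> sdom h -> lev h (dot lam h) (Sg lam) = mono lam.
Proof.
move=> dl dh; rewrite Sg_lev big_mkcond (bigD1_seq (1%:M)) ?Wl_uniq ?(introT (WlP _)) //=;
  last exact: inW1.
rewrite mulmx1 eqxx eps1 mulr1z big1_seq ?addr0 // => w /andP[w1 /WlP hw].
case: eqP => // e; case/eqP: w1; apply: (sdom_stab dl hw (@inW1 _ _ _)).
rewrite mulmx1; apply/esym/eqP; rewrite -subr_eq0; apply/eqP.
by apply: (cone_sdom_eq0 (sdom_cone dl hw) dh); rewrite dotBl e subrr.
Qed.

Lemma Sg_istop lam h : sdom lam -> sdom h -> istop h (dot lam h) (Sg lam).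
Proof.
move=> dl dh; split; first exact/Sg_bnd/sdom_wdom.
by rewrite Sg_lev_sdom // mono_neq0.
Qed.

Lemma Sg_neq0 lam : sdom lam -> Sg lam != 0.
Proof.
have [h hh] := dual_exists (fun=> 1) => dl.
by apply: (istop_neq0 (Sg_istop dl (h := h) _)) => i; rewrite hh.
Qed.

Lemma Sg_lead lam : sdom lam -> Sg lam lam = 1.
Proof.
move=> dl; have [h hh] := dual_exists (fun=> 1).
have dh : sdom h by move=> i; rewrite hh.
have := congr1 (fun f : GA => f lam) (Sg_lev_sdom dl dh).
by rewrite levE eqxx gcoef_mono eqxx.
Qed.

Definition face i lam : GA := mono lam - mono (lam *m s_ i).

(** The difference between [lam] and a conjugate lies in the cone, and [h] vanishes on it only if it
    is a multiple [t] of [al i]. Equality of norms leaves [t = 0] or [t = cpair (al i) lam], and the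
    stabilizer of [lam] is trivial. *)
Lemma Sg_face i lam h : sdom lam ->
  (forall j, dot (al j) h = (i != j)%:R) ->
  lev h (dot lam h) (Sg lam) = face i lam.
Proof.
move=> dl hh; have dh : wdom h by move=> j; rewrite hh ler0n.
have a0 := simple_neq0 i.
have hs : inW Phi (s_ i) by apply/inW_refl/simple_root.
have ns : s_ i != 1%:M.
  apply: contra_neq (a0) => e; have := refl_self a0; rewrite e mulmx1 => /eqP.
  by rewrite -addr_eq0 -mulr2n -scaler_nat scaler_eq0 pnatr_eq0 /= => /eqP.
have hih : dot (al i) h = 0 by rewrite hh eqxx.
rewrite Sg_lev big_mkcond (bigD1_seq (1%:M)) ?Wl_uniq ?(introT (WlP _)) //=;
  last exact: inW1.
rewrite -big_filter (bigD1_seq (s_ i)) ?filter_uniq ?Wl_uniq ?mem_filter ?ns ?(introT (WlP _)) //=.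
rewrite mulmx1 eqxx eps1 mulr1z eps_refl ?simple_root // mulrN1z.
rewrite ifT; last by rewrite reflE dotBl dotZl hih mulr0 subr0.
rewrite big1_seq ?addr0 // => w /andP[w2]; rewrite mem_filter => /andP[w1 /WlP hw].
case: eqP => // e; exfalso.
have e2 : lam - lam *m w = co i (lam - lam *m w) *: al i.
  have cn := sdom_cone dl hw; have /coneP cn' := cn.
  apply: co_eq => j; rewrite coZ co_al; case: (eqVneq j i) => [->|ji]; first by rewrite mulr1.
  rewrite mulr0; have /eqP : dot (lam - lam *m w) h = 0 by rewrite dotBl e subrr.
  rewrite {1}[lam - _]coE dot_suml psumr_eq0; last first.
    by move=> k _; rewrite dotZl mulr_ge0.
  move=> /allP/(_ j (mem_index_enum j)); rewrite /= dotZl hh [i == j]eq_sym ji mulr1.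
  by move/eqP.
move: e2; set t := co i _ => e2.
have e3 : lam *m w = lam - t *: al i by rewrite -e2 opprB addrC subrK.
have := inW_dot lam lam hw; rewrite e3 dotBl !dotBr !dotZl !dotZr (dotC lam (al i)).
rewrite (dot_cpair lam a0) => q.
have : t * (t - cpair (al i) lam) * dot (al i) (al i) = 0 by lra.
move/eqP; rewrite !mulf_eq0 dot_eq0 (negPf a0) orbF subr_eq0 => /orP[]/eqP te.
  case/eqP: w1; apply: (sdom_stab dl hw (@inW1 _ _ _)).
  by rewrite e3 te scale0r subr0 mulmx1.
case/eqP: w2; apply: (sdom_stab dl hw hs).
by rewrite e3 te reflE.
Qed.

Lemma face_neq0 i lam : sdom lam -> face i lam != 0.
Proof.
move=> dl; rewrite /face subr_eq0; apply/eqP => /gmono_inj/eqP.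
rewrite reflE -subr_eq0 opprB addrC subrK scaler_eq0 (negPf (simple_neq0 i)) orbF.
by apply/negP; rewrite gt_eqF // cpair_gt0 ?simple_neq0.
Qed.

Lemma Sg_face_istop i lam h : sdom lam ->
  (forall j, dot (al j) h = (i != j)%:R) -> istop h (dot lam h) (Sg lam).
Proof.
move=> dl hh; split; last by rewrite (Sg_face dl hh) face_neq0.
by apply: Sg_bnd => // j; rewrite hh ler0n.
Qed.

(** * Weyl denominator formula *)

Section Action.
Variable w : 'M[R]_n.
Hypothesis hw : inW Phi w.

Lemma act_fin f : finite_set (supp ((fun v => f (v *m w)) : GR R n)).
Proof.
apply: (@finite_supp _ _ _ [seq v *m w^T | v <- gsupp f]) => v fv.
by apply/mapP; exists (v *m w); rewrite ?mem_gsupp // inW_mulK.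
Qed.

Definition act f : GA := Ga (act_fin f).

Lemma actE f v : act f v = f (v *m w). Proof. by []. Qed.

Lemma ev_act (A : zmodType) f (phi : V -> A) :
  ev (act f) phi = ev f (fun v => phi (v *m w^T)).
Proof.
rewrite (@ev_widen _ _ _ [seq v *m w^T | v <- gsupp f]).
- by rewrite big_map; apply: eq_bigr => v _; rewrite actE inW_mulVK.
- rewrite map_inj_uniq ?gsupp_uniq //.
  by apply: (can_inj (g := fun v : V => v *m w)) => v; rewrite inW_mulVK.
- by move=> v fv; apply/mapP; exists (v *m w); rewrite ?mem_gsupp // inW_mulK.
Qed.

Lemma actM f g : act (f * g) = act f * act g.
Proof.
apply: ga_evP => phi; rewrite !(evM, ev_act); apply: eq_ev => v _.
by rewrite ev_act; apply: eq_ev => u _; rewrite mulmxDl.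
Qed.
Lemma actB f g : act (f - g) = act f - act g.
Proof. by apply/ga_ext/funext. Qed.
Lemma act_mono v : act (mono v) = mono (v *m w^T).
Proof. by apply: ga_evP => phi; rewrite ev_act !ev_mono. Qed.
Lemma act1 : act 1 = 1.
Proof. by rewrite -[1]/(mono 0) act_mono mul0mx. Qed.
Lemma act_prod (J : Type) (r : seq J) (F : J -> GA) :
  act (\prod_(k <- r) F k) = \prod_(k <- r) act (F k).
Proof. by elim/big_rec2: _ => [|k x y _ <-]; rewrite ?act1 ?actM. Qed.
End Action.

Lemma antisym_words f : (forall i v, f (v *m s_ i) = - f v) -> antisym f.
Proof.
move=> h w v /inW_word[s <-]; elim: s v => [|i s IH] v /=.
  by rewrite mulmx1 eps1 mul1r.
have hs : inW Phi (s_ i) by apply/inW_refl/simple_root.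
rewrite mulmxA IH h epsM //; last exact: word_inW.
by rewrite eps_refl ?simple_root // mulN1r mulrN mulNr.
Qed.

Section Denominator.
(** The three hypotheses say that the vectors [c b *: b] have the properties of a root system with
    the same Weyl group: [c_int] is the integrality of its Cartan numbers. Constant [c] rescales
    [Phi]; [c b = k / dot b b] gives multiples of the coroots. *)
Variable c : V -> R.
Hypothesis c_gt0 : forall b, b \in Phi -> 0 < c b.
Hypothesis c_refl : forall a b, a \in Phi -> b \in Phi -> c (b *m refl_mx a) = c b.
Hypothesis c_int : forall a b, a \in Phi -> b \in Phi ->
  exists z : int, cpair a (c b *: b) = z%:~R * c a.

Definition rhoc : V := 2^-1 *: \sum_(b <- Pos) c b *: b.
Definition den : GA := mono rhoc * \prod_(b <- Pos) (1 - mono (- (c b *: b))).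

Lemma rhoc_refl i : rhoc *m s_ i = rhoc - c (al i) *: al i.
Proof.
rewrite /rhoc (big_rem _ (al_Pos i)) /= -scalemxAl mulmxDl -scalemxAl refl_self ?simple_neq0 //.
have -> : (\sum_(b <- rem (al i) Pos) c b *: b) *m s_ i = \sum_(b <- rem (al i) Pos) c b *: b.
  rewrite -[RHS](perm_big _ (Pos_refl_perm i)) big_map mulmx_suml.
  apply: eq_big_seq => b /mem_rem/Pos_root bP.
  by rewrite c_refl ?simple_root // scalemxAl.
rewrite !scalerDr addrAC; congr (_ + _); rewrite !scalerN scalerA -scaleNr -scalerBl.
by congr (_ *: _); lra.
Qed.

Lemma cpair_rhoc i : cpair (al i) rhoc = c (al i).
Proof.
have := rhoc_refl i; rewrite reflE => /addrI/oppr_inj/eqP.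
rewrite -subr_eq0 -scalerBl scaler_eq0 (negPf (simple_neq0 i)) orbF subr_eq0.
by move/eqP.
Qed.

Lemma rhoc_sdom : sdom rhoc.
Proof.
by move=> i; rewrite -cpair_gt0 ?simple_neq0 // cpair_rhoc c_gt0 // simple_root.
Qed.

(** The reflection permutes the factors of the positive roots other than [al i]; the shift of the
    half sum by [c (al i) *: al i] turns the remaining factor into its opposite. *)
Lemma den_refl i v : den (v *m s_ i) = - den v.
Proof.
have hs : inW Phi (s_ i) by apply/inW_refl/simple_root.
suff : act hs den = - den by move/(congr1 (fun f : GA => f v)).
rewrite /den actM act_mono act_prod refl_tr rhoc_refl (big_rem _ (al_Pos i)) /=.
rewrite [in RHS](big_rem _ (al_Pos i)) /=.
rewrite -[in RHS](perm_big _ (Pos_refl_perm i)) big_map.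
set P1 := \prod_(j <- _) _; set P2 := \prod_(j <- _) _.
have -> : P1 = P2.
  apply: eq_big_seq => b /mem_rem/Pos_root bP.
  rewrite actB act1 act_mono refl_tr mulNmx -scalemxAl.
  by rewrite c_refl ?simple_root.
rewrite actB act1 act_mono refl_tr mulNmx -scalemxAl refl_self ?simple_neq0 //.
rewrite scalerN opprK monoD; set x := c _ *: _.
have e : mono (- x) * mono x = 1 :> GA by rewrite -monoD addNr.
rewrite -!mulrA -mulrN; congr (_ * _); rewrite mulrA mulrBr mulr1 e.
by rewrite -mulNr opprB.
Qed.

Lemma den_antisym : antisym den.
Proof. by apply: antisym_words => i v; apply: den_refl. Qed.

(** Membership in the cone alone would allow strictly dominant exponents of [den] other than [rhoc].
    The second condition makes pairings multiples of [c (al i)], which is the pairing of [rhoc]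
    itself. *)
Definition icone u := cone u /\ forall i, exists z : int, cpair (al i) u = z%:~R * c (al i).

Lemma icone_add u v : icone u -> icone v -> icone (u + v).
Proof.
move=> [c1 h1] [c2 h2]; split; first exact: coneD.
move=> i; have [z1 e1] := h1 i; have [z2 e2] := h2 i; exists (z1 + z2).
by rewrite cpairD e1 e2 rmorphD mulrDl.
Qed.
Lemma icone0 : icone 0.
Proof. by split; [exact: cone0|move=> i; exists 0; rewrite cpair0 mul0r]. Qed.

Lemma icone_root b : b \in Pos -> icone (c b *: b).
Proof.
move=> bP; split.
  by rewrite coneZ ?Pos_cone // ltW // c_gt0 // Pos_root.
by move=> i; apply: c_int; rewrite ?simple_root ?Pos_root.
Qed.

Lemma den_supp v : den v != 0 -> icone (rhoc - v).
Proof.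
rewrite /den gcoef_monoM.
suff h (s : seq V) u : {subset s <= Pos} ->
    (\prod_(b <- s) (1 - mono (- (c b *: b))) : GA) u != 0 -> icone (- u).
  by move/h; rewrite opprB; apply.
elim: s u => [|b s IH] u sub.
  rewrite big_nil gcoef1; case: (eqVneq u 0) => [->|//]; rewrite oppr0 => _; exact: icone0.
rewrite big_cons => /gcoefM_neq0[x [y [hx hy ->]]]; rewrite opprD; apply: icone_add; last first.
  by apply: IH hy => z zs; apply: sub; rewrite inE zs orbT.
move: hx; rewrite gcoefD gcoefN gcoef1 gcoef_mono.
case: (eqVneq x 0) => [-> _|_]; first by rewrite oppr0; apply: icone0.
case: (eqVneq x (- (c b *: b))) => [-> _|]; last by rewrite subrr eqxx.
by rewrite opprK; apply/icone_root/sub/mem_head.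
Qed.

Lemma den_lead : den rhoc = 1.
Proof.
have [h hh] := dual_exists (fun=> 1).
have dh : sdom h by move=> i; rewrite hh.
rewrite /den gcoef_monoM subrr.
have p b : b \in Pos -> 0 < dot (c b *: b) h.
  move=> bP; rewrite dotZl mulr_gt0 ?c_gt0 ?Pos_root //.
  by rewrite cone_sdom ?Pos_cone ?root_neq0 ?Pos_root.
suff hs (s : seq V) : {subset s <= Pos} ->
    bnd h 0 (\prod_(b <- s) (1 - mono (- (c b *: b)))) /\
    lev h 0 (\prod_(b <- s) (1 - mono (- (c b *: b)))) = 1.
  have [_ /(congr1 (fun f : GA => f 0))] := hs _ (fun _ => id).
  by rewrite levE dot0l eqxx gcoef1 eqxx.
elim: s => [|b s IH] sub.
  rewrite big_nil -[1]/(mono 0) lev_mono1 dot0l eqxx; split=> //.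
  by rewrite -[X in bnd _ X](dot0l h); apply: bnd_mono.
have [|b1 l1] := IH; first by move=> z zs; apply: sub; rewrite inE zs orbT.
have pb := p b (sub _ (mem_head _ _)).
have b2 : bnd h 0 (1 - mono (- (c b *: b)) : GA).
  move=> x; rewrite gcoefD gcoefN gcoef1 gcoef_mono.
  case: (eqVneq x 0) => [-> _|_]; first by rewrite dot0l.
  case: (eqVneq x (- (c b *: b))) => [-> _|]; last by rewrite subrr eqxx.
  by rewrite dotNl oppr_le0 ltW.
rewrite big_cons; split; first by rewrite -[X in bnd _ X]addr0; apply: bnd_mul.
rewrite -[X in lev _ X]addr0 lev_mul // l1 mulr1 levD -[1]/(mono 0).
rewrite -mulrN1z lev_mono lev_mono1 dot0l eqxx ifF ?addr0 //.
by rewrite dotNl oppr_eq0 gt_eqF.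
Qed.

(* An antisymmetric function is determined by its values at strictly dominant points; below
   [rhoc] and in its lattice, [rhoc] is the only one. *)
Lemma denominator_formula : Sg rhoc = den.
Proof.
apply/ga_ext/funext => v; have [w hw [dw _]] := dominant_conj v.
suff e : Sg rhoc (v *m w) = den (v *m w).
  by move: e; rewrite (Sg_antisym _ _ hw) (den_antisym _ hw) => /(mulfI (eps_neq0 w)).
move: (v *m w) dw => {hw w} {}v dw.
case: (eqVneq v rhoc) => [->|vr]; first by rewrite den_lead Sg_lead //; apply: rhoc_sdom.
have z0 f : antisym f -> ~ sdom v -> f v = 0.
  move=> af /existsNP[i /negP]; rewrite -leNgt => h.
  have h0 : dot (al i) v = 0 by apply/le_anti; rewrite h dw.
  have e : v *m s_ i = v by rewrite reflE /cpair h0 mulr0 mul0r scale0r subr0.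
  have := af (s_ i) v (inW_refl (simple_root i)).
  rewrite e eps_refl ?simple_root // mulN1r => /eqP.
  by rewrite -addr_eq0 -mulr2n mulrn_eq0 => /orP[] // /eqP.
have [sv|nsv] := pselect (sdom v); last by rewrite !z0 //; [exact: den_antisym|exact: Sg_antisym].
have -> : Sg rhoc v = 0.
  rewrite gcoef_sum big1_seq // => w /= /WlP hw; rewrite gcoefMz gcoef_mono.
  case: eqP => [e|]; last by rewrite mul0rz.
  case/eqP: vr; rewrite e (sdom_unique hw rhoc_sdom) ?mulmx1 //.
  by rewrite -e.
apply/esym/eqP; apply: contraT => /den_supp[cr ir]; case/eqP: vr.
(* A positive multiple of [c (al i)] is at least [c (al i)]. So [v - rhoc] is dominant while its
   opposite lies in the cone, which makes its squared norm non-positive. *)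
have wd : wdom (v - rhoc).
  move=> i; have a0 := simple_neq0 i; rewrite dot_cpair // divr_ge0 // mulr_ge0 ?dot_ge0 //.
  have cp : 0 < c (al i) by rewrite c_gt0 ?simple_root.
  have [z ez] := ir i; have := sv i; rewrite -cpair_gt0 //.
  move: ez; rewrite !cpairB cpair_rhoc => ez.
  have -> : cpair (al i) v = (1 - z)%:~R * c (al i) by rewrite rmorphB mulrBl -ez; ring.
  rewrite pmulr_lgt0 // ltr0z gtz0_ge1 => z1.
  by rewrite -{2}[c _]mul1r -mulrBl mulr_ge0 ?(ltW cp) // subr_ge0 ler1z.
have := cone_wdom cr wd; rewrite -opprB dotNl oppr_ge0 => h.
by apply/eqP; rewrite -subr_eq0 -dot_eq0 eq_le h dot_ge0.
Qed.

End Denominator.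

(** * Principal specialization *)

Lemma Pos_orbit b : b \in Pos -> exists i s, b = al i *m word s.
Proof.
move=> bP; apply: (Pos_conj_simple (N := (Num.truncn (height b)).+1) bP).
exact/ltW/truncnS_gt.
Qed.

(** A positive root arises from a simple one by simple reflections, and a reflection on one side of
    an orthogonal partition of the base fixes every vector supported on the other side. *)
Lemma simple_split (J : pred I) :
  (forall i j, J i -> ~~ J j -> dot (al i) (al j) = 0) ->
  forall x, x \in Phi -> (forall j, ~~ J j -> co j x = 0) \/ (forall j, J j -> co j x = 0).
Proof.
move=> hJ.
pose Q x := (forall j, ~~ J j -> co j x = 0) \/ (forall j, J j -> co j x = 0).
have Qrefl x k : Q x -> Q (x *m s_ k).
  have fix_k : (forall j, co j x != 0 -> dot (al k) (al j) = 0) -> x *m s_ k = x.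
    move=> h; suff e : dot (al k) x = 0 by rewrite reflE /cpair e mulr0 mul0r scale0r subr0.
    rewrite [x]coE dot_sumr big1 // => j _; rewrite dotZr.
    by case: (eqVneq (co j x) 0) => [->|/h ->]; rewrite ?mul0r ?mulr0.
  case=> hx; case: (boolP (J k)) => Jk.
  - left=> j Jj; rewrite co_refl ?hx //.
    by apply: contraNneq Jj => <-.
  - left=> j Jj; rewrite fix_k ?hx // => l; case: (boolP (J l)) => [Jl _|/hx ->].
      by rewrite dotC hJ.
    by rewrite eqxx.
  - right=> j Jj; rewrite fix_k ?hx // => l; case: (boolP (J l)) => [/hx ->|Jl _].
      by rewrite eqxx.
    by rewrite hJ.
  - right=> j Jj; rewrite co_refl ?hx //.
    by apply: contraNneq Jk => ->.
have Qpos x : x \in Pos -> Q x.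
  move=> xP; have [i [s ->]] := Pos_orbit xP.
  elim/last_ind: s => [|s k IH]; last by rewrite word_rcons mulmxA; apply: Qrefl.
  rewrite /= mulmx1; case: (boolP (J i)) => Ji; [left|right] => j Jj; rewrite co_al.
    by case: eqP Jj => // ->; rewrite Ji.
  by case: eqP Jj => // ->; rewrite (negPf Ji).
move=> x xP; case: (boolP (x \in Pos)) => [/Qpos //|].
by rewrite -PosN // => /Qpos; case=> h; [left|right] => j /h; rewrite coN => /eqP;
  rewrite oppr_eq0 => /eqP.
Qed.

Lemma base_nonempty : exists i : I, true.
Proof.
have [_ [Pne _] _] := HPD.
have [a aP] : exists a, a \in Phi.
  by case: (Phi) Pne => // a s _; exists a; apply: mem_head.
case: (posnP (size Delta)) => [s0|]; last by move=> h; exists (Ordinal h).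
have : a = 0; last by move/eqP; rewrite (negPf (root_neq0 aP)).
by rewrite [a]coE big1 // => i _; exfalso; have := ltn_ord i; rewrite [X in (_ < X)%N]s0.
Qed.

(** Connectedness of the Dynkin diagram: by [simple_split] an orthogonal partition of the base would
    extend to one of [Phi], against irreducibility. *)
Lemma simple_connected (J : pred I) : (exists i, J i) -> (exists j, ~~ J j) ->
  exists i j, [/\ J i, ~~ J j & dot (al i) (al j) != 0].
Proof.
move=> [i Ji] [j Jj]; apply: contrapT => h.
have hJ k l : J k -> ~~ J l -> dot (al k) (al l) = 0.
  move=> Jk Jl; apply/eqP; apply: contraT => nz; case: h; by exists k, l.
have spl := simple_split hJ.
have [_ [_ irr] _] := HPD.
case: (irr (fun x => [forall k, ~~ J k ==> (co k x == 0)])).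
- move=> a b aP bP /forallP h1 h2.
  have h3 : forall k, J k -> co k b = 0.
    case: (spl b bP) => // hb; case/negP: h2; apply/forallP => k; apply/implyP => /hb ->.
    by rewrite eqxx.
  rewrite [a]coE [b]coE dot_suml big1 // => k _; rewrite dot_sumr big1 // => l _.
  rewrite dotZl dotZr; case: (boolP (J k)) => Jk; last first.
    by have := h1 k; rewrite Jk /= => /eqP ->; rewrite mul0r.
  case: (boolP (J l)) => Jl; first by rewrite h3 // mul0r mulr0.
  by rewrite hJ // !mulr0.
- move=> /(_ _ (simple_root j))/forallP/(_ j).
  by rewrite Jj co_al eqxx oner_eq0.
- move=> /(_ _ (simple_root i))/negP; apply; apply/forallP => k; apply/implyP => Jk.
  have /negPf ki : k != i by apply: contraNneq Jk => ->.
  by rewrite co_al ki.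
Qed.

Lemma simple_obtuse i j : i != j -> dot (al i) (al j) <= 0.
Proof.
move=> ij; have ne : al i != al j.
  apply: contra_neq ij => e; have := co_al i j; rewrite -e co_al eqxx.
  by case: (eqVneq i j) => // _ /eqP; rewrite oner_eq0.
have /Pos_cone/coneP/(_ j) := Pos_refl (al_Pos i) ne.
rewrite reflE coB coZ !co_al eqxx eq_sym (negPf ij) mulr1 sub0r oppr_ge0 leNgt.
by rewrite cpair_gt0 ?simple_neq0 // -leNgt dotC.
Qed.

(** A root of maximal height works. If its support were not everything, connectedness would give a
    simple root outside the support and not orthogonal to it; it would pair negatively with the
    root, and the reflection would raise the height. *)
Lemma full_root : exists2 b, b \in Pos & forall i, 0 < co i b.
Proof.
have [h hh] := dual_exists (fun=> 1); have [i0 _] := base_nonempty.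
have [|b bP mx] := @seq_max _ _ Pos (fun b => dot b h).
  by have := al_Pos i0; case: Pos.
have /coneP cb := Pos_cone bP.
exists b => // i; rewrite ltNge; apply/negP => ci.
have [] := @simple_connected (fun i => 0 < co i b).
- apply: contrapT => nh; have : b = 0; last by apply/eqP; rewrite root_neq0 ?Pos_root.
  apply: co_eq => k; rewrite co0; apply/le_anti; rewrite cb andbT leNgt.
  by apply/negP => ?; apply: nh; exists k.
- by exists i; rewrite -leNgt.
move=> k [j [ck cj nz]].
have cj0 : co j b = 0 by apply/le_anti; rewrite cb andbT leNgt.
have neg : dot (al j) b < 0.
  rewrite [b]coE dot_sumr (bigD1 k) //= addrC -[X in _ < X]addr0; apply: ler_ltD.
    apply: sumr_le0 => l _; rewrite dotZr; case: (eqVneq j l) => [<-|jl].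
      by rewrite cj0 mul0r.
    by rewrite mulr_ge0_le0 // simple_obtuse.
  rewrite dotZr pmulr_rlt0 // lt_neqAle dotC nz simple_obtuse //.
  by apply: contraNneq cj => <-.
have bj : b != al j.
  by apply: contra_eq_neq cj0 => ->; rewrite co_al eqxx oner_eq0.
have := mx _ (Pos_refl bP bj); rewrite reflE dotBl dotZl hh mulr1.
have : cpair (al j) b < 0.
  by rewrite /cpair pmulr_llt0 ?invr_gt0 ?dot_gt0 ?simple_neq0 // pmulr_rlt0.
by move: (cpair _ _) (dot b h) => x y; lra.
Qed.

Lemma inv_len_refl (k : R) a b : a \in Phi ->
  k / dot (b *m refl_mx a) (b *m refl_mx a) = k / dot b b.
Proof. by move=> aP; rewrite inW_dot //; apply: inW_refl. Qed.

Lemma inv_len_int (k : R) a b : a \in Phi -> b \in Phi ->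
  exists z : int, cpair a ((k / dot b b) *: b) = z%:~R * (k / dot a a).
Proof.
move=> aP bP; have [z ez] := root_int bP aP; exists z.
rewrite -ez cpairZ /cpair dotC; field.
by rewrite !dot_eq0 !root_neq0.
Qed.

Lemma inv_len_gt0 (k : R) b : 0 < k -> b \in Phi -> 0 < k / dot b b.
Proof. by move=> k0 bP; rewrite divr_gt0 // dot_gt0 // root_neq0. Qed.

Definition rhov : V := rhoc (fun b => 2 / dot b b).

Lemma rhov_den : Sg rhov = den (fun b => 2 / dot b b).
Proof.
apply: denominator_formula => [b bP|a b aP bP|a b aP bP].
- exact: inv_len_gt0.
- exact: inv_len_refl.
- exact: inv_len_int.
Qed.

Definition echar h v : R := expR (dot v h).

Lemma echarD h u v : echar h (u + v) = echar h u * echar h v.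
Proof. by rewrite /echar dotDl expRD. Qed.
Lemma ev_echarM h f g : ev (f * g) (echar h) = ev f (echar h) * ev g (echar h).
Proof. by apply: ev_char => u v _ _; apply: echarD. Qed.
Lemma ev_echar1 h : ev (1 : GA) (echar h) = 1.
Proof. by rewrite -[1]/(mono 0) ev_mono /echar dot0l expR0. Qed.
Lemma ev_echar_prod (J : Type) (r : seq J) (F : J -> GA) h :
  ev (\prod_(k <- r) F k) (echar h) = \prod_(k <- r) ev (F k) (echar h).
Proof. by elim/big_rec2: _ => [|k x y _ <-]; rewrite ?ev_echar1 ?ev_echarM. Qed.

(* Exchanging the roles of exponent and evaluation point turns [Sg lam] at [rhov] into the
   Weyl denominator of the dual root system at [lam]. *)
Lemma principal_specialization lam : ev (Sg lam) (echar rhov) =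
  expR (dot rhov lam) * \prod_(b <- Pos) (1 - expR (- cpair b lam)).
Proof.
have -> : ev (Sg lam) (echar rhov) = ev (Sg rhov) (echar lam).
  rewrite /Sg !ev_sum -[in RHS](perm_big _ Wl_tr_perm) big_map.
  apply: eq_big_seq => w /WlP hw; rewrite !evMz !ev_mono eps_tr //.
  by rewrite /echar dot_trmx dotC.
rewrite rhov_den /den ev_echarM ev_mono ev_echar_prod; congr (_ * _).
apply: eq_bigr => b _; rewrite evD evN ev_echar1 ev_mono /echar dotNl dotZl.
by rewrite /cpair mulrAC.
Qed.

(** The difference of the two sides is the product of [1 - expR (- D)] and
    [expR (- y') - expR (- x)]. In the application [x], [y'] and [D] are the pairings of a positive
    root with [lam1], [mu1] and [mu2 - mu1]. *)
Lemma spec_factor_le (x y' D : R) : y' <= x -> 0 <= D ->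
  (1 - expR (- (x + D))) * (1 - expR (- y')) <= (1 - expR (- x)) * (1 - expR (- (y' + D)))
  ?= iff ((D == 0) || (x == y')).
Proof.
move=> xy D0; rewrite !opprD !expRD.
have hD : expR (- D) <= 1 by rewrite -expR0 ler_expR oppr_le0.
have hx : expR (- x) <= expR (- y') by rewrite ler_expR lerN2.
have e : (1 - expR (- x)) * (1 - expR (- y') * expR (- D)) -
   (1 - expR (- x) * expR (- D)) * (1 - expR (- y')) =
   (1 - expR (- D)) * (expR (- y') - expR (- x)) by ring.
split; first by rewrite -subr_ge0 e mulr_ge0 // subr_ge0.
rewrite eq_sym -subr_eq0 e mulf_eq0 !subr_eq0; congr (_ || _).
  by rewrite -expR0 (inj_eq (@expR_inj R)) eq_sym oppr_eq0.
by rewrite (inj_eq (@expR_inj R)) eqr_opp eq_sym.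
Qed.

Lemma full_pair b v : b \in Pos -> (forall i, 0 < co i b) -> wdom v -> v != 0 -> 0 < dot b v.
Proof.
move=> bP cb dv; apply: contraNT; rewrite -leNgt {1}[b]coE dot_suml => h.
have p i : 0 <= dot (co i b *: al i) v by rewrite dotZl mulr_ge0 // ltW.
have : \sum_i dot (co i b *: al i) v == 0 by rewrite eq_le h sumr_ge0.
rewrite psumr_eq0 // => /allP z; apply/eqP; apply: cpair_eq => i.
have := z i (mem_index_enum i); rewrite /= dotZl mulf_eq0 gt_eqF //= => /eqP e.
by rewrite cpair0 /cpair e mulr0 mul0r.
Qed.

Lemma quotient_comparable lam1 lam2 mu1 mu2 :
  sdom mu1 -> sdom lam1 -> wdom (lam1 - mu1) -> wdom (mu2 - mu1) ->
  lam1 + mu2 = lam2 + mu1 -> Sg lam1 * Sg mu2 = Sg lam2 * Sg mu1 ->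
  lam1 <> mu1 -> mu1 = mu2.
Proof.
move=> dm dl dlm dmm es eS ne; apply/eqP; apply: contraT => nm; exfalso.
have el : lam2 = lam1 + (mu2 - mu1) by rewrite addrA es addrK.
have em : mu2 = mu1 + (mu2 - mu1) by rewrite addrC subrK.
have := congr1 (fun f : GA => ev f (echar rhov)) eS.
rewrite !ev_echarM !principal_specialization !mulrA.
(* The exponential prefactors of the two sides agree since [lam1 + mu2 = lam2 + mu1]; only the
   products over positive roots remain to be compared. *)
rewrite ![_ * _ * expR _]mulrAC -!expRD -!dotDr es -!mulrA.
move/(mulfI (lt0r_neq0 (expR_gt0 _))); rewrite -!big_split /= => /eqP.
apply/negP; rewrite gt_eqF //.
have pos b v : b \in Pos -> wdom v -> 0 <= cpair b v.
  move=> bP dv; rewrite /cpair divr_ge0 ?dot_ge0 // mulr_ge0 //.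
  by apply: cone_wdom dv; apply: Pos_cone.
have fac b : b \in Pos ->
  (1 - expR (- cpair b lam2)) * (1 - expR (- cpair b mu1)) <=
  (1 - expR (- cpair b lam1)) * (1 - expR (- cpair b mu2))
  ?= iff ((cpair b (mu2 - mu1) == 0) || (cpair b lam1 == cpair b mu1)).
  move=> bP; have -> : cpair b lam2 = cpair b lam1 + cpair b (mu2 - mu1) by rewrite -cpairD -el.
  have -> : cpair b mu2 = cpair b mu1 + cpair b (mu2 - mu1) by rewrite -cpairD -em.
  by apply: spec_factor_le; rewrite ?pos // -subr_ge0 -cpairB pos.
apply: prod_strict => [b bP|].
  have dl2 : sdom lam2.
    by move=> i; rewrite el dotDr ltr_wpDr.
  have gt v : sdom v -> 0 < 1 - expR (- cpair b v).
    move=> dv; rewrite subr_gt0 -expR0 ltr_expR oppr_lt0 cpair_gt0 ?root_neq0 ?Pos_root //.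
    by apply: cone_sdom; rewrite ?Pos_cone ?root_neq0 ?Pos_root.
  by rewrite mulr_gt0 ?gt // (fac b bP).
have [b bP cb] := full_root; exists b => //.
have b0 := root_neq0 (Pos_root bP).
rewrite lt_neqAle (fac b bP) (fac b bP).1 andbT negb_or.
rewrite gt_eqF /=; last by rewrite cpair_gt0 // full_pair // subr_eq0 eq_sym.
rewrite -subr_eq0 -cpairB gt_eqF // cpair_gt0 // full_pair // subr_eq0.
exact/eqP.
Qed.

(** * Root lengths and special weights *)

(** If [x] is not orthogonal to some [a *m w] and [y] is orthogonal to the whole orbit of [a],
    reflecting [a *m w] in [x] shows that [x] and [y] are orthogonal. Irreducibility then forbids
    roots of the second kind. *)
Lemma orbit_nonorth a b : a \in Phi -> b \in Phi -> exists2 w, inW Phi w & dot (a *m w) b != 0.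
Proof.
move=> aP bP; have [_ [_ irr] _] := HPD.
case: (irr (fun x => `[< exists2 w, inW Phi w & dot (a *m w) x != 0 >])).
- move=> x y xP yP /asboolP[w hw nz] /asboolP ny.
  have ey w' : inW Phi w' -> dot (a *m w') y = 0.
    by move=> hw'; apply/eqP; apply: contraT => h; case: ny; exists w'.
  have := ey _ (inW_mul hw (inW_refl xP)); rewrite mulmxA reflE dotBl dotZl ey // sub0r.
  move/eqP; rewrite oppr_eq0 mulf_eq0 => /orP[|/eqP //].
  rewrite /cpair dotC !mulf_eq0 invr_eq0 dot_eq0 (negPf nz) (negPf (root_neq0 xP)) orbF.
  by rewrite pnatr_eq0.
- by move=> /(_ b bP)/asboolP.
- move=> /(_ a aP)/asboolP; case; exists 1%:M; first exact: inW1.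
  by rewrite mulmx1 dot_eq0 root_neq0.
Qed.

(** After moving [a] within its orbit to be non-orthogonal to [b], the two Cartan integers have a
    positive product, below 4 by the strict Cauchy-Schwarz inequality. The one of smaller absolute
    value is therefore 1 or -1, and the product is the ratio of squared lengths. *)
Lemma len_ratio a b : a \in Phi -> b \in Phi -> dot a a <= dot b b ->
  exists2 k : nat, k \in [:: 1; 2; 3]%N & dot b b = k%:R * dot a a.
Proof.
move=> aP bP; have [w hw] := orbit_nonorth aP bP.
have a'P := inW_root hw aP; rewrite -(inW_dot a a hw); move: (a *m w) a'P => {hw w aP} {}a aP nz le.
have pa := dot_gt0 (root_neq0 aP); have pb := dot_gt0 (root_neq0 bP).
have [[t e]|np] := pselect (exists t, b = t *: a).
  exists 1%N; rewrite // mul1r e dotZl dotZr.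
  by have := root_prop aP (c := t); rewrite -e => /(_ bP)[] ->; ring.
have cs : dot a b * dot a b < dot a a * dot b b.
  apply: CauchySchwarz_strict; first exact: root_neq0.
  by move=> t e; apply: np; exists t.
have [zp ep] := root_int aP bP; have [zq eq] := root_int bP aP.
have ep' : zp%:~R * dot a a = 2 * dot a b.
  by rewrite -ep /cpair divfK // gt_eqF.
have eq' : zq%:~R * dot b b = 2 * dot a b.
  by rewrite -eq /cpair divfK ?gt_eqF // (dotC b a).
have ab2 : 0 < dot a b * dot a b by rewrite -expr2 exprn_even_gt0.
have pab : 0 < dot a a * dot b b by rewrite mulr_gt0.
have epq : (zp * zq)%:~R * (dot a a * dot b b) = 4 * (dot a b * dot a b) :> R.
  by rewrite rmorphM /= mulrACA ep' eq'; ring.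
have z0 : 0 < zp * zq.
  by rewrite -(ltr0z R) -(pmulr_lgt0 _ pab) epq; lra.
have z4 : zp * zq < 4.
  by rewrite -(ltr_int R) -(ltr_pM2r pab) epq -[4%:~R]/(4%:R) ltr_pM2l.
have eqq : (zq * zq)%:~R * dot b b = (zp * zq)%:~R * dot a a :> R.
  by rewrite !rmorphM /= -mulrA eq' mulrAC ep' mulrC.
have q3 : zq * zq <= zp * zq.
  rewrite -(ler_int R) -(ler_pM2r pb) eqq ler_pM2l // ltr0z //.
have q1 : zq * zq = 1.
  have q2 : -2 < zq /\ zq < 2 by move: q3 z4; clear; nia.
  have q0 : zq != 0 by apply: contraTneq z0 => ->; rewrite mulr0.
  have : zq = 1 \/ zq = -1 by move: q2 q0; clear; lia.
  by case=> ->.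
rewrite q1 mul1r in eqq.
exists (absz (zp * zq)); last by rewrite eqq natr_absz gtr0_norm.
by move: z0 z4; clear; move: (zp * zq) => z; rewrite !inE; lia.
Qed.

Lemma maxlen_root : exists2 a, a \in Phi & dot a a = maxlen Phi.
Proof.
have [h1 _ [e|[a aP e]]] := bigmaxP Phi (fun a => dot a a) 0; last by exists a.
have [i _] := base_nonempty; have := h1 _ (simple_root i).
by rewrite e leNgt dot_gt0 ?simple_neq0.
Qed.
Lemma maxlen_ge b : b \in Phi -> dot b b <= maxlen Phi.
Proof. by have [h1 _ _] := bigmaxP Phi (fun a => dot a a) 0; apply: h1. Qed.
Lemma maxlen_gt0 : 0 < maxlen Phi.
Proof. by have [a aP <-] := maxlen_root; rewrite dot_gt0 ?root_neq0. Qed.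
Lemma minlen_root : exists2 a, a \in Phi & dot a a = minlen Phi.
Proof.
have [_ _ [e|[a aP e]]] := bigminP Phi (fun a => dot a a) (maxlen Phi); last by exists a.
by have [a aP ea] := maxlen_root; exists a; rewrite // ea -[RHS]/(minlen Phi) /minlen e.
Qed.
Lemma minlen_le b : b \in Phi -> minlen Phi <= dot b b.
Proof. by have [h1 _ _] := bigminP Phi (fun a => dot a a) (maxlen Phi); apply: h1. Qed.

(** A length strictly between the extremes would split the ratio [m] into two integral factors
    larger than 1, impossible for [m] at most 3; so there are at most two root lengths. *)
Lemma mPhi_spec : exists m : nat, [/\ m \in [:: 1; 2; 3]%N, mPhi Phi = m%:R &
  forall b, b \in Phi -> maxlen Phi / dot b b = if is_long Phi b then 1 else m%:R].
Proof.
have [aM MP eM] := maxlen_root; have [am mP em] := minlen_root.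
have [m hm e] : exists2 k : nat, k \in [:: 1; 2; 3]%N & maxlen Phi = k%:R * minlen Phi.
  by have := len_ratio mP MP; rewrite eM em; apply; apply: (le_trans (minlen_le MP)); rewrite eM.
have m0 : minlen Phi != 0 by rewrite -em dot_eq0 root_neq0.
exists m; split=> //; first by rewrite /mPhi e mulfK.
move=> b bP; have b0 : dot b b != 0 by rewrite dot_eq0 root_neq0.
rewrite /is_long; case: eqP => [<-|nl]; first by rewrite divff.
have := len_ratio bP MP; rewrite eM => /(_ (maxlen_ge bP))[k hk ek].
have := len_ratio mP bP; rewrite em => /(_ (minlen_le bP))[l hl el].
have kl : m = (k * l)%N.
  by apply/eqP; rewrite -(eqr_nat R) -(inj_eq (mulIf m0)) -e ek el natrM mulrA.
have l1 : l = 1%N.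
  case: (eqVneq k 1%N) => [k1|k1]; first by case: nl; rewrite ek k1 mul1r.
  by move: hm hk hl k1; rewrite kl !inE; nia.
by rewrite ek mulfK // kl l1 muln1.
Qed.

Lemma cpair_omega i j : cpair (al j) (omega i) = (i == j)%:R.
Proof.
rewrite /omega; case: xgetP => [v -> h|]; first exact: h.
by have [v hv] := cpair_exists (fun j => (i == j)%:R) => /(_ v); case.
Qed.

Lemma cpair_omega_sum (t : I -> R) j : cpair (al j) (\sum_i t i *: omega i) = t j.
Proof.
rewrite cpair_sum (bigD1 j) //= cpairZ cpair_omega eqxx mulr1 big1 ?addr0 // => i /negPf ij.
by rewrite cpairZ cpair_omega ij mulr0.
Qed.

Lemma cpair_rho i : cpair (al i) (rho Delta) = 1.
Proof.
rewrite -(cpair_omega_sum (fun=> 1) i) /rho; congr cpair.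
by apply: eq_bigr => j _; rewrite scale1r.
Qed.

Lemma cpair_rhot i : cpair (al i) (rhot Phi Delta) = if is_long Phi (al i) then 1 else mPhi Phi.
Proof. exact: (cpair_omega_sum (fun i => if is_long Phi (al i) then 1 else mPhi Phi)). Qed.

Definition special mu := pos_mult (rho Delta) mu \/ pos_mult (rhot Phi Delta) mu.

Definition spec_by (c : V -> R) mu :=
  [/\ mu = rhoc c, Sg mu = den c,
      forall b w, b \in Phi -> inW Phi w -> c (b *m w) = c b,
      forall i, c (al i) = cpair (al i) mu &
      forall b, b \in Phi -> exists2 k : nat, (0 < k)%N & c b = k%:R].

(** For [d rho] the function [c] is constantly [d]. For [d rhot] it is [d * maxlen / dot b b], equal
    to [d] on long roots and to [d] times the length ratio on short ones. *)
Lemma special_by mu : special mu -> exists c, spec_by c mu.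
Proof.
have [m [hm em hl]] := mPhi_spec.
have m0 : (0 < m)%N by case: (m) hm.
case=> -[d [d0 ->]]; have dR : 0 < d%:R :> R by rewrite ltr0n.
  have ci a b : a \in Phi -> b \in Phi ->
      exists z : int, cpair a (d%:R *: b) = z%:~R * d%:R.
    by move=> aP bP; have [z ez] := root_int aP bP; exists z; rewrite cpairZ ez mulrC.
  have e : d%:R *: rho Delta = rhoc (fun=> d%:R).
    by apply: cpair_eq => i; rewrite cpair_rhoc // cpairZ cpair_rho mulr1.
  exists (fun=> d%:R); split=> //.
  - by rewrite e denominator_formula.
  - by move=> i; rewrite e cpair_rhoc.
  - by move=> b _; exists d.
pose c b : R := d%:R * maxlen Phi / dot b b.
have cE b : b \in Phi -> c b = d%:R * if is_long Phi b then 1 else m%:R.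
  by move=> bP; rewrite /c -mulrA hl.
have c0 b : b \in Phi -> 0 < c b.
  by apply: inv_len_gt0; rewrite mulr_gt0 // maxlen_gt0.
have cr a b : a \in Phi -> b \in Phi -> c (b *m refl_mx a) = c b.
  by move=> aP bP; apply: inv_len_refl.
have ci a b : a \in Phi -> b \in Phi -> exists z : int, cpair a (c b *: b) = z%:~R * c a.
  by move=> aP bP; apply: inv_len_int.
have e : d%:R *: rhot Phi Delta = rhoc c.
  by apply: cpair_eq => i; rewrite cpair_rhoc // cpairZ cpair_rhot em cE ?simple_root.
exists c; split=> //.
- by rewrite e denominator_formula.
- by move=> b w bP hw; rewrite /c inW_dot.
- by move=> i; rewrite e cpair_rhoc.
- move=> b bP; exists (d * if is_long Phi b then 1 else m)%N.
    by rewrite muln_gt0 d0; case: ifP.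
  by rewrite natrM cE //; case: ifP.
Qed.

Lemma dom_reg_sdom lam : dom_reg Phi Delta lam -> sdom lam.
Proof. by case=> _ h i; rewrite -cpair_gt0 ?simple_neq0 // h // mem_nth. Qed.

Lemma wdom_cpair v : (forall i, 0 <= cpair (al i) v) -> wdom v.
Proof.
by move=> h i; rewrite dot_cpair ?simple_neq0 // divr_ge0 // mulr_ge0 ?dot_ge0.
Qed.

Lemma wdivides_wdom mu lam : sdom mu -> sdom lam -> wdivides Delta mu lam -> wdom (lam - mu).
Proof.
move=> dm dl dv; apply: wdom_cpair => i; have [k e] := dv (al i) (mem_nth _ (ltn_ord i)).
have := dl i; have := dm i; rewrite -!cpair_gt0 ?simple_neq0 // cpairB e => pm.
rewrite pmulr_lgt0 // ltr0z gtz0_ge1 => k1.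
by rewrite -[X in _ - X]mul1r -mulrBl mulr_ge0 ?(ltW pm) // subr_ge0 ler1z.
Qed.

Lemma lev_cross h c1 c2 d1 d2 (f1 f2 g1 g2 : GA) :
  istop h c1 f1 -> istop h c2 f2 -> istop h d1 g1 -> istop h d2 g2 ->
  f1 * f2 = g1 * g2 -> lev h c1 f1 * lev h c2 f2 = lev h d1 g1 * lev h d2 g2.
Proof.
move=> t1 t2 u1 u2 e; have := istop_mul t1 t2; rewrite e => tt.
have ec := istop_uniq tt (istop_mul u1 u2).
by rewrite -(lev_mul t1.1 t2.1) -(lev_mul u1.1 u2.1) -ec e.
Qed.

Lemma lead_cross lam1 lam2 mu1 mu2 : sdom lam1 -> sdom lam2 -> sdom mu1 -> sdom mu2 ->
  Sg lam1 * Sg mu2 = Sg lam2 * Sg mu1 -> lam1 + mu2 = lam2 + mu1.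
Proof.
move=> l1 l2 m1 m2 e; have [h hh] := dual_exists (fun=> 1).
have dh : sdom h by move=> i; rewrite hh.
have := lev_cross (Sg_istop l1 dh) (Sg_istop m2 dh) (Sg_istop l2 dh) (Sg_istop m1 dh) e.
by rewrite !Sg_lev_sdom // -!monoD => /gmono_inj.
Qed.

(** When the two edge identities are expanded, the extreme terms cancel and a sum of two mixed
    exponentials is left on each side. With positive coefficients nothing cancels, so
    [lam1 *m s_i + mu2] is one of the two exponents on the right; the two options are the two
    alternatives. *)
Lemma face_cross i lam1 lam2 mu1 mu2 : sdom lam1 -> sdom lam2 -> sdom mu1 -> sdom mu2 ->
  Sg lam1 * Sg mu2 = Sg lam2 * Sg mu1 ->
  cpair (al i) lam1 = cpair (al i) lam2 \/ cpair (al i) lam1 = cpair (al i) mu1.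
Proof.
move=> l1 l2 m1 m2 e; have es := lead_cross l1 l2 m1 m2 e.
have [h hh] := dual_exists (fun j => (i != j)%:R).
have := lev_cross (Sg_face_istop l1 hh) (Sg_face_istop m2 hh) (Sg_face_istop l2 hh)
          (Sg_face_istop m1 hh) e.
rewrite !(Sg_face _ hh) // /face => ef.
have a0 := simple_neq0 i.
have {ef} : mono (lam1 *m s_ i + mu2) + mono (lam1 + mu2 *m s_ i) =
       mono (lam2 *m s_ i + mu1) + mono (lam2 + mu1 *m s_ i) :> GA.
  have e1 : mono lam1 * mono mu2 = mono lam2 * mono mu1 :> GA by rewrite -!monoD es.
  have e2 : mono (lam1 *m s_ i) * mono (mu2 *m s_ i) =
            mono (lam2 *m s_ i) * mono (mu1 *m s_ i) :> GA.
    by rewrite -!monoD -!mulmxDl es.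
  rewrite !monoD; apply/eqP; rewrite -subr_eq0; apply/eqP.
  have -> : mono (lam1 *m s_ i) * mono mu2 + mono lam1 * mono (mu2 *m s_ i) -
    (mono (lam2 *m s_ i) * mono mu1 + mono lam2 * mono (mu1 *m s_ i)) =
    (mono lam2 - mono (lam2 *m s_ i)) * (mono mu1 - mono (mu1 *m s_ i)) -
    (mono lam1 - mono (lam1 *m s_ i)) * (mono mu2 - mono (mu2 *m s_ i)) +
    (mono lam1 * mono mu2 - mono lam2 * mono mu1) +
    (mono (lam1 *m s_ i) * mono (mu2 *m s_ i) -
     mono (lam2 *m s_ i) * mono (mu1 *m s_ i)) :> GA by ring.
  by rewrite ef e1 e2 !subrr !addr0.
move/(congr1 (fun f : GA => f (lam1 *m s_ i + mu2))); rewrite !gcoefD !gcoef_mono eqxx.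
have key (x y : R) : x *: al i = y *: al i -> x = y.
  by move/eqP; rewrite -subr_eq0 -scalerBl scaler_eq0 (negPf a0) orbF subr_eq0 => /eqP.
case: (eqVneq (lam1 *m s_ i + mu2) (lam2 *m s_ i + mu1)) => [E _|_].
2: case: (eqVneq (lam1 *m s_ i + mu2) (lam2 + mu1 *m s_ i)) => [E _|_]; last by case: eqP.
  left; move: E; rewrite !reflE addrAC es [X in _ = X]addrAC => /addrI/oppr_inj; exact: key.
right; move: E; rewrite !reflE addrAC es addrA => /addrI/oppr_inj; exact: key.
Qed.

(** Only [x rho] against [y rhot] needs an argument: they are comparable if [x <= y] or
    [x >= y * mPhi Phi], and strictly between these bounds [x] differs from the value of [y rhot] at
    long and at short simple roots alike. *)
Lemma special_compare mu1 mu2 : special mu1 -> special mu2 ->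
  [\/ wdom (mu2 - mu1), wdom (mu1 - mu2) | forall i, cpair (al i) mu1 <> cpair (al i) mu2].
Proof.
have [m [hm em _]] := mPhi_spec.
have m1 : 1 <= mPhi Phi by rewrite em ler1n; case: (m) hm.
have gen (r1 r2 : V) (x y : R) : r1 = r2 -> (forall i, 0 <= cpair (al i) r1) ->
  wdom (y *: r2 - x *: r1) \/ wdom (x *: r1 - y *: r2).
  move=> <- h; rewrite -!scalerBl; case: (lerP x y) => xy; [left|right];
    by apply: wdom_cpair => i; rewrite cpairZ mulr_ge0 // subr_ge0 // ltW.
have mix (x y : R) : 0 <= y -> [\/ wdom (y *: rhot Phi Delta - x *: rho Delta),
   wdom (x *: rho Delta - y *: rhot Phi Delta) |
   forall i, cpair (al i) (x *: rho Delta) <> cpair (al i) (y *: rhot Phi Delta)].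
  move=> y0; case: (lerP x y) => xy.
    apply: Or31; apply: wdom_cpair => i; rewrite cpairB !cpairZ cpair_rho cpair_rhot.
    by case: ifP => _; rewrite ?mulr1; nra.
  case: (lerP (y * mPhi Phi) x) => xy2.
    apply: Or32; apply: wdom_cpair => i; rewrite cpairB !cpairZ cpair_rho cpair_rhot.
    by case: ifP => _; rewrite ?mulr1; nra.
  apply: Or33 => i; rewrite !cpairZ cpair_rho cpair_rhot.
  by case: ifP => _; rewrite ?mulr1; lra.
have rp i : 0 <= cpair (al i) (rho Delta) by rewrite cpair_rho.
have tp i : 0 <= cpair (al i) (rhot Phi Delta).
  by rewrite cpair_rhot; case: ifP => _; rewrite ?(le_trans _ m1).
move=> [] [d [_ ->]] [] [e [_ ->]].
- by case: (gen _ _ d%:R e%:R erefl rp) => h; [apply: Or31|apply: Or32].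
- exact: mix.
- case: (mix e%:R d%:R (ler0n _ _)) => h; [exact: Or32|exact: Or31|].
  by apply: Or33 => i /esym/h.
- by case: (gen _ _ d%:R e%:R erefl tp) => h; [apply: Or31|apply: Or32].
Qed.

Theorem quotient_unique lam1 lam2 mu1 mu2 :
  sdom lam1 -> sdom lam2 -> sdom mu1 -> sdom mu2 -> special mu1 -> special mu2 ->
  wdivides Delta mu1 lam1 -> wdivides Delta mu2 lam2 ->
  Sg lam1 * Sg mu2 = Sg lam2 * Sg mu1 -> lam1 <> mu1 -> lam1 = lam2 /\ mu1 = mu2.
Proof.
move=> l1 l2 m1 m2 s1 s2 v1 v2 e ne; have es := lead_cross l1 l2 m1 m2 e.
suff em : mu1 = mu2 by split=> //; move: es; rewrite em => /addIr.
have ne2 : lam2 <> mu2.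
  by move=> e2; apply: ne; move: es; rewrite e2 addrC => /addrI.
case: (special_compare s1 s2) => h.
- by apply: (quotient_comparable m1 l1 (wdivides_wdom m1 l1 v1) h es e).
- apply/esym.
  by apply: (quotient_comparable m2 l2 (wdivides_wdom m2 l2 v2) h (esym es) (esym e)).
case: ne; apply: cpair_eq => i.
case: (face_cross i l1 l2 m1 m2 e) => // ei; case: (h i).
have := congr1 (cpair (al i)) es; rewrite !cpairD ei => /addrI ->.
by [].
Qed.

(** * Greatest proper special divisors *)

Definition suppP f := forall v, f v != 0 -> inP Phi v.

Lemma is_intD (x y : R) : is_int x -> is_int y -> is_int (x + y).
Proof. by move=> [z ->] [t ->]; exists (z + t); rewrite rmorphD. Qed.
Lemma is_intN (x : R) : is_int x -> is_int (- x).
Proof. by move=> [z ->]; exists (- z); rewrite rmorphN. Qed.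
Lemma is_intM (x y : R) : is_int x -> is_int y -> is_int (x * y).
Proof. by move=> [z ->] [t ->]; exists (z * t); rewrite rmorphM. Qed.

Lemma inPD u v : inP Phi u -> inP Phi v -> inP Phi (u + v).
Proof. by move=> hu hv a aP; rewrite cpairD; apply: is_intD; [apply: hu|apply: hv]. Qed.
Lemma inPN v : inP Phi v -> inP Phi (- v).
Proof. by move=> hv a aP; rewrite cpairN; apply/is_intN/hv. Qed.
Lemma inP0 : inP Phi 0.
Proof. by move=> a _; exists 0; rewrite cpair0. Qed.
Lemma inP_root b : b \in Phi -> inP Phi b.
Proof. by move=> bP a aP; apply: root_int. Qed.
Lemma inPZn (k : nat) v : inP Phi v -> inP Phi (k%:R *: v).
Proof.
by move=> hv a aP; rewrite cpairZ; apply: is_intM; [exists k|apply: hv].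
Qed.

Lemma cpairNl a v : cpair (- a) v = - cpair a v.
Proof. by rewrite /cpair !dotNl dotNr opprK mulrN mulNr. Qed.

(** Every root is, up to sign, [al i *m word s]. Peeling a reflection off the word changes [v] by an
    integral multiple of a simple root, which preserves the hypothesis. *)
Lemma inP_simple v : (forall i, is_int (cpair (al i) v)) -> inP Phi v.
Proof.
move=> hv; have hw s i : is_int (cpair (al i *m word s) v).
  elim/last_ind: s v hv i => [|s j IH] v hv i; first by rewrite /= mulmx1.
  have hs : inW Phi (s_ j) by apply/inW_refl/simple_root.
  rewrite word_rcons mulmxA -[v](inW_mulK v hs) refl_tr cpair_ortho; last exact: inW_ortho.
  apply: IH => k; rewrite reflE cpairB cpairZ; apply/is_intD => //.
  by apply/is_intN/is_intM => //; apply: root_int; apply: simple_root.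
have hp b : b \in Pos -> is_int (cpair b v).
  by move=> bP; have [i [s ->]] := Pos_orbit bP.
move=> a aP; case: (boolP (a \in Pos)) => [/hp //|]; rewrite -PosN // => /hp.
by rewrite cpairNl => /is_intN; rewrite opprK.
Qed.

Lemma suppPM f g : suppP f -> suppP g -> suppP (f * g).
Proof. by move=> hf hg v /gcoefM_neq0[u [w [/hf hu /hg hw ->]]]; apply: inPD. Qed.
Lemma suppP_mono v : inP Phi v -> suppP (mono v).
Proof. by move=> hv u; rewrite gcoef_mono; case: (eqVneq u v) => [->|]. Qed.
Lemma suppP1 : suppP 1.
Proof. by apply: suppP_mono; apply: inP0. Qed.
Lemma suppPD f g : suppP f -> suppP g -> suppP (f + g).
Proof.
move=> hf hg v; rewrite gcoefD; case: (eqVneq (f v) 0) => [->|/hf //].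
by rewrite add0r; apply: hg.
Qed.
Lemma suppPN f : suppP f -> suppP (- f).
Proof. by move=> hf v; rewrite gcoefN oppr_eq0; apply: hf. Qed.
Lemma suppP_sum (J : Type) (r : seq J) (F : J -> GA) :
  (forall k, suppP (F k)) -> suppP (\sum_(k <- r) F k).
Proof.
move=> h; elim/big_rec: _ => [|k x _ hx]; last exact: suppPD.
by move=> v; rewrite gcoef0 eqxx.
Qed.
Lemma suppP_lev h c f : suppP f -> suppP (lev h c f).
Proof. by move=> hf v; rewrite levE; case: ifP => _ //; apply: hf. Qed.

Lemma monoX v k : mono v ^+ k = mono (k%:R *: v) :> GA.
Proof.
elim: k => [|k IH]; first by rewrite scale0r expr0.
by rewrite exprS IH -monoD -natr1 scalerDl scale1r addrC.
Qed.

(** Factor by factor this is the geometric sum for [1 - x ^+ k] over [1 - x], where [x] is the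
    exponential of [- (c b *: b)]. *)
Lemma den_quotient (c c' : V -> R) (k : V -> nat) :
  (forall b, b \in Pos -> c' b = (k b)%:R * c b) ->
  den c' = den c * (mono (rhoc c' - rhoc c) *
    \prod_(b <- Pos) \sum_(j < k b) mono (- (c b *: b)) ^+ j).
Proof.
move=> hk; rewrite /den mulrACA -monoD addrC subrK -big_split; congr (_ * _).
apply: eq_big_seq => b bP /=; rewrite hk // -scalerA -scalerN -monoX.
by rewrite -opprB subrX1 -mulNr opprB.
Qed.

(** The functions [c] attached to [mu] and [nu] are invariant and every positive root is conjugate
    to a simple one, so integrality of their ratio spreads from the simple roots to all factors of
    the product. *)
Lemma special_dvd mu nu : inP Phi mu -> inP Phi nu -> special mu -> special nu ->
  (forall i, exists k : nat, cpair (al i) mu = k%:R * cpair (al i) nu) ->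
  exists2 Q, suppP Q & Sg mu = Sg nu * Q.
Proof.
move=> Pm Pn /special_by[c' [e' d' w' s' n']] /special_by[c [e d w s nn]] hk.
have hk' b : b \in Pos -> exists k : nat, c' b = k%:R * c b.
  move=> bP; have [i [t eb]] := Pos_orbit bP; have [k ek] := hk i.
  exists k; rewrite eb w' ?w ?simple_root //; try exact: word_inW.
  by rewrite s' s.
pose k b := xget 0%N [set k : nat | c' b = k%:R * c b]%classic.
have kE b : b \in Pos -> c' b = (k b)%:R * c b.
  move=> /hk'[l el]; rewrite /k; case: xgetP => [x -> //|/(_ l)]; by case.
rewrite d' d (den_quotient kE) -e -e'.
eexists; last by [].
apply: suppPM; first by apply: suppP_mono; apply: inPD => //; apply: inPN.
rewrite big_seq; elim/big_rec: _ => [|b x bP hx]; first exact: suppP1.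
apply: suppPM => //; apply: suppP_sum => j; rewrite monoX; apply: suppP_mono.
apply/inPZn/inPN; have [l _ ->] := nn b (Pos_root bP).
by apply/inPZn/inP_root/Pos_root.
Qed.

(** Truncation loses nothing: for a dominant regular weight the pairing is already a positive
    integer. *)
Definition mc lam i : nat := Num.truncn (cpair (al i) lam).

Lemma mcE lam i : dom_reg Phi Delta lam -> cpair (al i) lam = (mc lam i)%:R /\ (0 < mc lam i)%N.
Proof.
case=> hP hp; have [z ez] := hP _ (simple_root i).
have := hp (al i) (mem_nth _ (ltn_ord i)); rewrite /mc ez ltr0z => z0.
case: z z0 {ez} => // k k0; rewrite -[(Posz k)%:~R]/(k%:R) natrK; split=> //.
Qed.

Lemma mc_eq lam mu : dom_reg Phi Delta lam -> dom_reg Phi Delta mu ->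
  (forall i, mc lam i = mc mu i) -> lam = mu.
Proof.
by move=> dl dm h; apply: cpair_eq => i; rewrite (mcE i dl).1 (mcE i dm).1 h.
Qed.

Lemma mc_dvd mu lam : dom_reg Phi Delta mu -> dom_reg Phi Delta lam ->
  wdivides Delta mu lam <-> forall i, (mc mu i %| mc lam i)%N.
Proof.
move=> dm dl; split=> [h i|h a aD].
  have [k] := h (al i) (mem_nth _ (ltn_ord i)).
  rewrite (mcE i dm).1 (mcE i dl).1 => e; have [_ m0] := mcE i dm; have [_ l0] := mcE i dl.
  have : (Posz (mc lam i)) = k * Posz (mc mu i) :> int.
    by apply: (@intr_inj R); rewrite rmorphM /= -!pmulrn.
  by move=> ez; apply/dvdnP; exists (absz k); rewrite -[LHS]/(absz (Posz (mc lam i))) ez abszM.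
have ia : (index a Delta < size Delta)%N by rewrite index_mem.
have := h (Ordinal ia) => /dvdnP[k e]; exists (Posz k).
have := (mcE (Ordinal ia) dl).1; have := (mcE (Ordinal ia) dm).1; rewrite /= nth_index //.
by move=> -> ->; rewrite e natrM.
Qed.

(** * Dictionary between special weights and functions with natural values *)

Section LongShort.
Variable m : nat.
Hypothesis m123 : m \in [:: 1; 2; 3]%N.
Hypothesis mE : mPhi Phi = m%:R.
Hypothesis mlen : forall b, b \in Phi ->
  maxlen Phi / dot b b = if is_long Phi b then 1 else m%:R.
Local Notation L := (fun i : I => is_long Phi (al i)).

Lemma long_or_prime : (forall i, L i) \/ prime m.
Proof.
case: (eqVneq m 1%N) => [m1|]; last by move: m123; rewrite !inE => /or3P[]/eqP ->; [|right|right].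
left=> i; have := mlen (simple_root i); rewrite m1 if_same => /eqP.
rewrite /is_long -(inj_eq (mulIf (_ : dot (al i) (al i) != 0))) ?dot_eq0 ?simple_neq0 //.
by rewrite divfK ?dot_eq0 ?simple_neq0 // mul1r eq_sym.
Qed.

Lemma m_gt0 : (0 < m)%N. Proof. by case: (m) m123. Qed.

Lemma special_dom_reg mu : special mu -> dom_reg Phi Delta mu.
Proof.
have m0 := m_gt0.
have h i : special mu -> exists2 k : nat, (0 < k)%N & cpair (al i) mu = k%:R.
  case=> -[d [d0 ->]]; rewrite cpairZ ?cpair_rho ?cpair_rhot.
    by exists d; rewrite ?mulr1.
  rewrite mE; case: ifP => _; first by exists d; rewrite ?mulr1.
  by exists (d * m)%N; rewrite ?muln_gt0 ?d0 // natrM.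
move=> sm; split.
  by apply: inP_simple => i; have [k _ ->] := h i sm; exists (Posz k).
move=> a aD; have ia : (index a Delta < size Delta)%N by rewrite index_mem.
have [k k0] := h (Ordinal ia) sm; rewrite /= nth_index // => ->.
by rewrite ltr0n.
Qed.

Lemma mc_special mu : special mu -> spf L m (mc mu).
Proof.
case=> -[d [d0 ->]]; [left|right]; exists d => // i; rewrite /mc cpairZ ?cpair_rho ?cpair_rhot.
  by rewrite mulr1 natrK.
by rewrite mE; case: ifP => _; rewrite ?mulr1 -?natrM natrK // mulnC.
Qed.

Lemma spf_special (x : I -> nat) : spf L m x -> exists2 mu, special mu & forall i, mc mu i = x i.
Proof.
case=> -[d d0 hx].
  exists (d%:R *: rho Delta); first by left; exists d.
  by move=> i; rewrite /mc cpairZ cpair_rho mulr1 natrK hx.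
exists (d%:R *: rhot Phi Delta); first by right; exists d.
by move=> i; rewrite /mc cpairZ cpair_rhot mE hx; case: ifP => _;
  rewrite ?mulr1 -?natrM natrK // mulnC.
Qed.

Lemma pspf_proper lam (x : I -> nat) : dom_reg Phi Delta lam -> pspf L m (mc lam) x ->
  exists2 mu, proper_special Phi Delta lam mu & forall i, mc mu i = x i.
Proof.
move=> dl [sx dx [j nj]]; have [mu sm hm] := spf_special sx; exists mu => //; split=> //.
  by apply/(mc_dvd (special_dom_reg sm) dl) => i; rewrite hm.
by move=> e; rewrite -hm e eqxx in nj.
Qed.

Lemma proper_pspf lam mu : dom_reg Phi Delta lam -> proper_special Phi Delta lam mu ->
  pspf L m (mc lam) (mc mu).
Proof.
move=> dl [sm dv ne]; have dm := special_dom_reg sm; split; first exact: mc_special.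
  by move=> i; apply: (mc_dvd dm dl).1.
apply: contrapT => h; apply: ne; apply: (mc_eq dm dl) => i.
by apply/eqP; apply: contraT => hi; case: h; exists i.
Qed.

Definition max_special lam mu := proper_special Phi Delta lam mu /\
  forall nu, proper_special Phi Delta lam nu -> wdivides Delta nu mu.

Lemma maxspf_max lam (x : I -> nat) : dom_reg Phi Delta lam -> maxspf L m (mc lam) x ->
  exists mu, max_special lam mu.
Proof.
move=> dl [px mx]; have [mu pm hm] := pspf_proper dl px; exists mu; split=> // nu pn.
have [sm _ _] := pm; have [sn _ _] := pn.
apply/(mc_dvd (special_dom_reg sn) (special_dom_reg sm)) => i.
by rewrite hm; apply: mx; apply: proper_pspf.
Qed.

Lemma spf_mc_special lam : dom_reg Phi Delta lam -> spf L m (mc lam) -> special lam.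
Proof.
move=> dl /spf_special[mu sm hm]; suff -> : lam = mu by [].
by apply: (mc_eq dl (special_dom_reg sm)) => i; rewrite hm.
Qed.

(** * The lcm in the presence of a greatest proper special divisor *)

Lemma epsP w : eps Delta w = 1 \/ eps Delta w = -1.
Proof. by rewrite /eps -signr_odd; case: odd; [right|left]. Qed.

Lemma act_Sg w (hw : inW Phi w) lam : act hw (Sg lam) = Sg lam *~ eps Delta w.
Proof.
apply/ga_ext/funext => v; rewrite gcoefMz actE Sg_antisym // mulrC.
by rewrite -[RHS]mulrzr intz.
Qed.

Lemma dvdGR_ga f (g : GR R n) : dvdGR Phi f g -> exists2 q, suppP q & g = coef (f * q).
Proof. by case=> q [[qf qP] ->]; exists (Ga qf) => // v; apply: qP. Qed.

Lemma ga_dvdGR f g : suppP g -> dvdGR Phi f (coef (f * g)).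
Proof. by move=> gP; exists g; split=> //; split=> [|v]; [exact: ga_fin|apply: gP]. Qed.

Lemma Sg_suppP lam : dom_reg Phi Delta lam -> suppP (Sg lam).
Proof.
move=> dl v /Sg_supp[w hw ->] a aP; rewrite -[a](inW_mulVK a hw) cpair_ortho.
  by apply: dl.1; apply: inW_root => //; apply: inW_tr.
exact: inW_ortho.
Qed.

Lemma rho_special : special (rho Delta).
Proof. by left; exists 1%N; rewrite scale1r. Qed.

(** Comparing top parts shows that the quotient has leading term [mono (mu - nu)]; its coefficient 1
    is what fixes the sign of the lcm. *)
Lemma quotient_lead mu nu Q h : sdom mu -> sdom nu -> sdom h -> Sg mu = Sg nu * Q ->
  Q (mu - nu) = 1 /\ bnd h (dot (mu - nu) h) Q.
Proof.
move=> dm dn dh e; have Q0 : Q != 0.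
  by apply/eqP => Q0; have := Sg_neq0 dm; rewrite e Q0 mulr0 eqxx.
have [c tc] := istop_exists h Q0.
have t1 : istop h 0 (1 : GA).
  split; first by rewrite -[X in bnd _ X](dot0l h); apply: bnd_mono.
  by rewrite -[1]/(mono 0) lev_mono1 dot0l eqxx mono_neq0.
have e1 : Sg mu * 1 = Sg nu * Q by rewrite mulr1.
have := lev_cross (Sg_istop dm dh) t1 (Sg_istop dn dh) tc e1.
rewrite !Sg_lev_sdom // -[1]/(mono 0) lev_mono1 dot0l eqxx mulr1.
rewrite -{1}(subrK nu mu) addrC monoD => /(ga_mulfI (mono_neq0 nu)).
move/(congr1 (fun f : GA => f (mu - nu))); rewrite gcoef_mono eqxx levE.
by case: eqP => // -> <-; split=> //; apply: tc.1.
Qed.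

(** Let [Q] be the quotient of [Sg mu] by [Sg (rho Delta)]. It is an invariant common multiple, so
    [D] divides it, and it divides [D] because [mu] is itself one of the divisors. The unit between
    them is an exponential up to sign; its exponent is fixed by all simple reflections, hence 0, and
    the sign follows from the leading coefficients. *)
Lemma lcm_max lam mu D : dom_reg Phi Delta lam -> max_special lam mu ->
  is_D Phi Delta lam D -> exists2 Dg : GA, coef Dg = D & Sg (rho Delta) * Dg = Sg mu.
Proof.
move=> dl [pm mx] [[Df DP] DW Dlead Ddvd Dmin].
have [sm vm ne] := pm.
have rm := special_dom_reg sm; have rr := special_dom_reg rho_special.
have dm := dom_reg_sdom rm; have dr := dom_reg_sdom rr.
have [Q PQ eQ] : exists2 Q, suppP Q & Sg mu = Sg (rho Delta) * Q.
  apply: special_dvd => //; [exact: rm.1|exact: rr.1|exact: rho_special|].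
  by move=> i; exists (mc mu i); rewrite cpair_rho mulr1 (mcE i rm).1.
have r0 := Sg_neq0 dr; have Q0 : Q != 0.
  by apply/eqP => Q0; have := Sg_neq0 dm; rewrite eQ Q0 mulr0 eqxx.
have QW w (hw : inW Phi w) : act hw Q = Q.
  have := congr1 (act hw) eQ; rewrite actM !act_Sg eQ.
  by case: (epsP w) => ->; [rewrite !mulr1z|rewrite !mulrN1z mulNr => /oppr_inj];
    move=> /esym/(ga_mulfI r0).
pose Dg : GA := Ga Df.
have [q2 Pq2 e2] : exists2 q, suppP q & Q = Dg * q.
  have [|q Pq e] := @dvdGR_ga Dg Q; last by exists q => //; apply: ga_ext.
  apply: Dmin.
  - by split; [exact: ga_fin|move=> v; apply: PQ].
  - by move=> w hw v; rewrite -[LHS](actE hw) QW.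
  move=> nu pn; have [sn vn _] := pn; have rn := special_dom_reg sn.
  rewrite !SgE -gcoefM -eQ.
  have [q Pq ->] : exists2 q, suppP q & Sg mu = Sg nu * q; last exact: ga_dvdGR.
  apply: special_dvd => //; [exact: rm.1|exact: rn.1|] => i.
  have /(mc_dvd rn rm)/(_ i)/dvdnP[k ek] := mx nu pn.
  by exists k; rewrite (mcE i rm).1 (mcE i rn).1 ek natrM.
have [q1 Pq1 e1] : exists2 q, suppP q & Dg = Q * q.
  have := Ddvd mu pm; rewrite !SgE => /dvdGR_ga[q Pq e]; exists q => //.
  have : Sg (rho Delta) * Dg = Sg mu * q by apply: ga_ext.
  by rewrite eQ -mulrA => /(ga_mulfI r0).
have /ga_unit[v [k [k1 eq1]]] : q1 * q2 = 1.
  by apply: (ga_mulfI Q0); rewrite mulr1 mulrA -e1 -e2.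
have v0 : v = 0.
  apply: cpair_eq => i; rewrite cpair0.
  have hs : inW Phi (s_ i) by apply/inW_refl/simple_root.
  have aD : act hs Dg = Dg by apply/ga_ext/funext => u; apply: DW.
  have : act hs q1 = q1.
    by apply: (ga_mulfI Q0); rewrite -{1}(QW _ hs) -actM -e1 aD e1.
  move/(congr1 (fun f : GA => f v)); rewrite actE eq1 !gcoefMz !gcoef_mono eqxx reflE.
  rewrite -subr_eq0 addrAC subrr sub0r oppr_eq0 scaler_eq0 (negPf (simple_neq0 i)) orbF.
  by case: eqP => // _; case: k1 => ->.
exists Dg => //; rewrite eQ; congr (_ * _).
move: e1; rewrite eq1 v0 (_ : mono 0 = 1) //; case: k1 => -> e1; first by rewrite e1 mulr1z mulr1.
have [h hh] := dual_exists (fun=> 1); have dh : sdom h by move=> i; rewrite hh.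
have [Ql Qb] := quotient_lead dm dr dh eQ.
have DQ u : D u = - Q u.
  by have := congr1 (fun f : GA => f u) e1; rewrite mulrN1z mulrN1 gcoefN.
have [_ /(_ (mu - rho Delta))] := Dlead; rewrite DQ Ql => /(_ isT) Dl; exfalso.
suff : 0 < - 1 :> int by [].
apply: Dl => nu; rewrite DQ oppr_eq0 => /Qb nb [c hc].
apply/eqP; rewrite -subr_eq0; apply/eqP.
have cn : cone (nu - (mu - rho Delta)).
  by rewrite hc; apply: cone_sum => i _; rewrite coneZ ?cone_al ?ler0n.
by apply: (cone_sdom_eq0 cn dh); rewrite dotBl subr_le0.
Qed.

(** * Roots of unity on a face *)

Section RootsOfUnity.
Variable i : I.

Definition kp v : int := Num.floor (cpair (al i) v).

Lemma kpD u v : inP Phi u -> inP Phi v -> kp (u + v) = kp u + kp v.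
Proof.
move=> hu hv; have [x ex] := hu _ (simple_root i); have [y ey] := hv _ (simple_root i).
by rewrite /kp cpairD ex ey -rmorphD /= !intrKfloor.
Qed.

Lemma kp_mc lam : dom_reg Phi Delta lam -> kp lam = mc lam i.
Proof. by move=> dl; rewrite /kp (mcE i dl).1 pmulrn intrKfloor. Qed.

Lemma kp_refl lam : dom_reg Phi Delta lam -> kp (lam *m s_ i) = - (mc lam i : int).
Proof.
move=> dl; rewrite /kp reflE cpairB cpairZ cpairaa ?simple_neq0 // (mcE i dl).1.
have -> : (mc lam i)%:R - (mc lam i)%:R * 2 = (- (mc lam i : int))%:~R :> R.
  by rewrite rmorphN /= -pmulrn; ring.
by rewrite intrKfloor.
Qed.

Definition zchar (z : algC) v : algC := z ^ kp v.
(** The operator z d/dz applied to [zchar]. It obeys the product rule with respect to [zchar], which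
    allows simple zeros to be told from multiple ones. *)
Definition zder (z : algC) v : algC := (kp v)%:~R * z ^ kp v.

Section Evaluation.
Variable z : algC.
Hypothesis z0 : z != 0.

Lemma zcharD u v : inP Phi u -> inP Phi v -> zchar z (u + v) = zchar z u * zchar z v.
Proof. by move=> hu hv; rewrite /zchar kpD // expfzDr. Qed.

Lemma ev_zcharM f g : suppP f -> suppP g ->
  ev (f * g) (zchar z) = ev f (zchar z) * ev g (zchar z).
Proof. by move=> hf hg; apply: ev_char => u v /hf hu /hg hv; apply: zcharD. Qed.

Lemma ev_zderM f g : suppP f -> suppP g ->
  ev (f * g) (zder z) = ev f (zder z) * ev g (zchar z) + ev f (zchar z) * ev g (zder z).
Proof.
move=> hf hg; rewrite evM /ev !mulr_suml -big_split; apply: eq_big_seq => u /=.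
rewrite mem_gsupp => /hf hu; rewrite !mulrzAl -mulrzDl; congr (_ *~ _).
rewrite !mulr_sumr -big_split; apply: eq_big_seq => v /=.
rewrite mem_gsupp => /hg hv; rewrite !mulrzAr -mulrzDl; congr (_ *~ _).
by rewrite /zder /zchar kpD // expfzDr // rmorphD /=; ring.
Qed.

Lemma ev_face_zchar lam : dom_reg Phi Delta lam ->
  ev (face i lam) (zchar z) = z ^+ mc lam i - z ^- mc lam i.
Proof.
by move=> dl; rewrite evD evN !ev_mono /zchar kp_mc // kp_refl // -invr_expz -exprnP.
Qed.

Lemma ev_face_zder lam : dom_reg Phi Delta lam ->
  ev (face i lam) (zder z) = (mc lam i)%:R * (z ^+ mc lam i + z ^- mc lam i).
Proof.
move=> dl; rewrite evD evN !ev_mono /zder kp_mc // kp_refl // -invr_expz -exprnP.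
by rewrite rmorphN /= -pmulrn; ring.
Qed.

End Evaluation.

Lemma face_supp lam : dom_reg Phi Delta lam -> suppP (face i lam).
Proof.
move=> dl; apply: suppPD; first exact/suppP_mono/dl.1.
apply/suppPN/suppP_mono; rewrite reflE; apply: inPD; first exact: dl.1.
by apply/inPN; rewrite (mcE i dl).1; apply/inPZn/inP_root/simple_root.
Qed.

(** Multiplying by [z ^+ k] turns the equation into [z ^+ (2 * k) = 1]; hence the order [2 * K]. *)
Lemma face_root (z : algC) (K k : nat) : (0 < K)%N -> (2 * K).-primitive_root z ->
  (z ^+ k - z ^- k == 0) = (K %| k)%N.
Proof.
move=> K0 pz; have z0 : z != 0.
  by rewrite (prim_root_eq0 pz) muln_eq0 /= gtn_eqF.
have zk : z ^+ k != 0 by rewrite expf_neq0.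
rewrite subr_eq0 -(inj_eq (mulIf zk)) mulVf // -exprD addnn -mul2n.
by rewrite -(prim_order_dvd pz) dvdn_pmul2l.
Qed.

Section Cross.
(** In the application [G] is [Sg (rho Delta)] times the lcm of [lam2], which is not yet known to be
    [Sg mu2] for some [mu2]. *)
Variables (lam1 lam2 mu1 : V) (G : GA).
Hypotheses (d1 : dom_reg Phi Delta lam1) (d2 : dom_reg Phi Delta lam2).
Hypotheses (dm : dom_reg Phi Delta mu1) (GP : suppP G).
Hypothesis eG : Sg lam1 * G = Sg lam2 * Sg mu1.

Let G0 : G != 0.
Proof.
apply/eqP => G0; have := ga_mul_neq0 (Sg_neq0 (dom_reg_sdom d2)) (Sg_neq0 (dom_reg_sdom dm)).
by rewrite -eG G0 mulr0 eqxx.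
Qed.

Lemma cross_face : exists h c, [/\ forall j, dot (al j) h = (i != j)%:R, istop h c G &
  face i lam1 * lev h c G = face i lam2 * face i mu1].
Proof.
have [h hh] := dual_exists (fun j => (i != j)%:R); have [c tc] := istop_exists h G0.
exists h, c; split=> //; have ds := dom_reg_sdom.
have := lev_cross (Sg_face_istop (ds _ d1) hh) tc (Sg_face_istop (ds _ d2) hh)
  (Sg_face_istop (ds _ dm) hh) eG.
by rewrite !(Sg_face _ hh) //; apply: ds.
Qed.

(** At a primitive root of unity of order [2 * mc lam1 i] the left side of the edge identity
    vanishes, so one of the two binomials on the right does. *)
Lemma cross_dvd : (mc lam1 i %| mc lam2 i)%N || (mc lam1 i %| mc mu1 i)%N.
Proof.
have [h [c [hh tc e]]] := cross_face; have [_ a0] := mcE i d1.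
have [z pz] := C_prim_root_exists (n := 2 * mc lam1 i) (ltac:(by rewrite muln_gt0 a0)).
have fz := face_root _ a0 pz.
have z0 : z != 0 by rewrite (prim_root_eq0 pz) muln_eq0 /= gtn_eqF.
have := congr1 (fun f : GA => ev f (zchar z)) e.
rewrite (ev_zcharM z0 (face_supp d1) (@suppP_lev h c _ GP)).
rewrite (ev_zcharM z0 (face_supp d2) (face_supp dm)).
rewrite !ev_face_zchar // => /eqP; have /eqP -> : z ^+ mc lam1 i - z ^- mc lam1 i == 0.
  by rewrite fz dvdnn.
by rewrite mul0r eq_sym mulf_eq0 !fz.
Qed.

(* Otherwise a primitive [2 K]-th root of unity is a simple zero of the right-hand side of the
   face identity and at least a double zero of the left-hand side. *)
Lemma cross_gcd delta q (K : nat) : dom_reg Phi Delta delta -> suppP q -> Sg delta * q = G ->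
  (0 < K)%N -> (K %| mc lam1 i)%N -> (K %| mc lam2 i)%N -> (K %| mc delta i)%N ->
  (K %| mc mu1 i)%N.
Proof.
move=> dd qP eq K0 k1 k2 kd; have [h [c [hh tc e]]] := cross_face.
have q0 : q != 0 by apply/eqP => q0; move: G0; rewrite -eq q0 mulr0 eqxx.
have [c' tq] := istop_exists h q0.
have eq2 : face i delta * lev h c' q = lev h c G.
  have td := Sg_face_istop (dom_reg_sdom dd) hh.
  have := istop_mul td tq; rewrite eq => /(istop_uniq tc) ->.
  by rewrite -eq (lev_mul td.1 tq.1) (Sg_face _ hh) //; apply: dom_reg_sdom.
have [z pz] := C_prim_root_exists (n := 2 * K) (ltac:(by rewrite muln_gt0 K0)).
have fz := face_root _ K0 pz.
have z0 : z != 0 by rewrite (prim_root_eq0 pz) muln_eq0 /= gtn_eqF.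
have vz lam : dom_reg Phi Delta lam -> (K %| mc lam i)%N -> ev (face i lam) (zchar z) = 0.
  by move=> dl kl; apply/eqP; rewrite ev_face_zchar // fz.
have levP : suppP (lev h c G) by apply: suppP_lev.
have Gz : ev (lev h c G) (zchar z) = 0.
  by rewrite -eq2 (ev_zcharM z0 (face_supp dd) (@suppP_lev h c' _ qP)) vz // mul0r.
have := congr1 (fun f : GA => ev f (zder z)) e.
rewrite (ev_zderM z0 (face_supp d1) levP) (ev_zderM z0 (face_supp d2) (face_supp dm)).
rewrite Gz (vz lam1) // (vz lam2) // !mul0r mulr0 !addr0 => /esym/eqP.
(* Only the term with the derivative of [face i lam2] survives. At [z] the two powers in this
   derivative coincide, so it equals [2 * mc lam2 i] times a power of [z] and is nonzero; the other
   factor, from [mu1], must vanish. *)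
rewrite mulf_eq0 ev_face_zder // ev_face_zchar // fz => /orP[|//].
have /eqP : z ^+ mc lam2 i - z ^- mc lam2 i == 0 by rewrite fz.
move/subr0_eq => <-; have [_ m0] := mcE i d2.
by rewrite mulf_eq0 pnatr_eq0 gtn_eqF //= -mulr2n mulrn_eq0 /= expf_eq0 (negPf z0) andbF.
Qed.

End Cross.
End RootsOfUnity.

Theorem reduced_quotient_unique lam1 lam2 (D1 D2 : GR R n) :
  dom_reg Phi Delta lam1 -> dom_reg Phi Delta lam2 -> ~ special lam1 ->
  is_D Phi Delta lam1 D1 -> is_D Phi Delta lam2 D2 ->
  mulGR (S Phi Delta lam1) D2 = mulGR (S Phi Delta lam2) D1 -> lam1 = lam2.
Proof.
move=> d1 d2 ns1 hD1 hD2; have lp := long_or_prime.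
have ns lam : dom_reg Phi Delta lam -> ~ special lam -> exists mu, max_special lam mu.
  move=> dl nl; have [|x mx] := maxspf_nonspecial lp (fun i => (mcE i dl).2).
    by move=> h; apply: nl; apply: spf_mc_special.
  exact: maxspf_max mx.
have [mu1 max1] := ns _ d1 ns1.
have [Dg1 <- e1] := lcm_max d1 max1 hD1.
have [[Df2 DP2] _ _ Ddvd2 _] := hD2.
pose Dg2 : GA := Ga Df2.
rewrite !SgE => eD.
have {}eD : Sg lam1 * Dg2 = Sg lam2 * Dg1 by apply: ga_ext.
have [[sm1 vm1 nm1] _] := max1.
have rm1 := special_dom_reg sm1; have rr := special_dom_reg rho_special.
(* Multiplying the identity by [Sg (rho Delta)] replaces the lcm of [lam1] by [Sg mu1], while the
   lcm of [lam2] stays hidden in [G]. *)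
pose G := Sg (rho Delta) * Dg2.
have eG : Sg lam1 * G = Sg lam2 * Sg mu1.
  by rewrite /G mulrCA eD mulrCA e1.
have GP : suppP G by apply: suppPM; [exact: Sg_suppP|move=> v; apply: DP2].
have [mu2 max2] : exists mu, max_special lam2 mu.
  have [s2|/(ns _ d2) //] := pselect (special lam2).
  (* Any simple root at which [lam1] and [mu1] differ provides the edge; [a] and [b] of the
     arithmetic lemma are their values there. *)
  have [i ni] : exists i, mc mu1 i != mc lam1 i.
    apply: contrapT => h; apply: nm1; apply: (mc_eq rm1 d1) => i.
    by apply/eqP; apply: contraT => hi; case: h; exists i.
  have ba := (mc_dvd rm1 d1).1 vm1 i; have [_ a0] := mcE i d1.
  have nab : ~~ (mc lam1 i %| mc mu1 i)%N.
    by apply: contra ni => ab; rewrite eqn_dvd ba ab.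
  have al2 : (mc lam1 i %| mc lam2 i)%N.
    by have := cross_dvd i d1 d2 rm1 GP eG; rewrite (negPf nab) orbF.
  (* Each proper special divisor [delta] of [lam2] yields a factor [Sg delta] of [G]; this supplies
     the two hypotheses on [y] of the arithmetic lemma, with [K = a] and with [K] the gcd. *)
  have cross y K : pspf L m (mc lam2) y -> (0 < K)%N -> (K %| mc lam1 i)%N ->
      (K %| y i)%N -> (K %| mc mu1 i)%N.
    move=> /(pspf_proper d2)[delta pd hy] K0 k1 ky; have [sd _ _] := pd.
    have := Ddvd2 delta pd; rewrite !SgE => /dvdGR_ga[q qP eq].
    apply: (cross_gcd d1 d2 rm1 GP eG (special_dom_reg sd) qP) => //.
    - by apply: ga_ext; rewrite -eq.
    - exact: dvdn_trans al2.
    - by rewrite hy.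
  have [||x mx] := maxspf_special lp (mc_special s2) a0 ba ni al2.
  - by move=> y py; apply: contra nab => /(cross y _ py a0 (dvdnn _)).
  - by move=> y py; apply: (cross y) => //; rewrite ?gcdn_gt0 ?a0 ?dvdn_gcdl ?dvdn_gcdr.
  exact: maxspf_max mx.
have [[sm2 vm2 _] _] := max2.
have [Dg2' eD2 e2] := lcm_max d2 max2 hD2.
have EG : G = Sg mu2 by rewrite /G -e2; congr (_ * _); apply: ga_ext.
have ds := dom_reg_sdom; have rm2 := special_dom_reg sm2.
have [] // := quotient_unique (ds _ d1) (ds _ d2) (ds _ rm1) (ds _ rm2) sm1 sm2 vm1 vm2.
  by rewrite -EG.
by move=> e; apply: nm1.
Qed.
End LongShort.

End WeylGroup.

Theorem theorem2p5 (R : realType) (n : nat) (Phi Delta : seq 'rV[R]_n) :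
  simple_based_root_system Phi Delta ->
  (forall lam1 lam2 mu1 mu2 : 'rV[R]_n,
     dom_reg Phi Delta lam1 -> dom_reg Phi Delta lam2 ->
     dom_reg Phi Delta mu1 -> dom_reg Phi Delta mu2 ->
     (pos_mult (rho Delta) mu1 \/ pos_mult (rhot Phi Delta) mu1) ->
     (pos_mult (rho Delta) mu2 \/ pos_mult (rhot Phi Delta) mu2) ->
     wdivides Delta mu1 lam1 -> wdivides Delta mu2 lam2 ->
     (* S(lam1)/S(mu1) = S(lam2)/S(mu2) in Frac Z[P] *)
     mulGR (S Phi Delta lam1) (S Phi Delta mu2) =
       mulGR (S Phi Delta lam2) (S Phi Delta mu1) ->
     (* the quotient is not 1 *)
     S Phi Delta lam1 <> S Phi Delta mu1 ->
     lam1 = lam2 /\ mu1 = mu2) /\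
  (forall (lam1 lam2 : 'rV[R]_n) (D1 D2 : GR R n),
     dom_reg Phi Delta lam1 -> dom_reg Phi Delta lam2 ->
     ~ int_mult (rho Delta) lam1 -> ~ int_mult (rhot Phi Delta) lam1 ->
     is_D Phi Delta lam1 D1 -> is_D Phi Delta lam2 D2 ->
     (* C(lam1) = C(lam2), i.e. S(lam1)/D(lam1) = S(lam2)/D(lam2) *)
     mulGR (S Phi Delta lam1) D2 = mulGR (S Phi Delta lam2) D1 ->
     lam1 = lam2).
Proof.
move=> HPD; have [m [m123 mE mlen]] := mPhi_spec HPD.
have ds := dom_reg_sdom HPD; split.
  move=> lam1 lam2 mu1 mu2 d1 d2 e1 e2 s1 s2 v1 v2; rewrite !(SgE HPD) => eS ne.
  apply: (quotient_unique HPD) => //; try exact: ds.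
    exact: ga_ext.
  by move=> e; apply: ne; rewrite e.
move=> lam1 lam2 D1 D2 d1 d2 nr nt h1 h2.
apply: (reduced_quotient_unique HPD m123 mE mlen d1 d2 _ h1 h2).
by case=> -[d [_ e]]; [apply: nr|apply: nt]; exists (Posz d).
Qed.
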